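(* Consider the unitary irreducible representation $V(1)$ (i.e. $\mathfrak{p}=1$) of $\mathfrak{osp}(1|12)$. For $E\in\mathbb{Q}$ and $j\in\mathbb{Z}_{\ge 0}$ let $m(E,j)$ be the multiplicity of the $(2j+1)$-dimensional irreducible representation of the total angular momentum algebra $\mathfrak{so}(3)$ in the eigenspace of $\hat H$ in $V(1)$ with eigenvalue $\hbar\omega E$. Then, as formal power series in $z$ with coefficients in $\mathbb{Z}[J]$, $$\sum_{E,j} m(E,j)\, z^{E} J^{j} = \frac{(1+Jz^2)\, z^3}{(1-z^2)^3 (1-Jz)^2}.$$
   Context: The Lie superalgebra $\mathfrak{osp}(1|2n)$ is generated by odd elements $b_a^{\pm}$ ($a=1,\dots,n$) subject to $[\{b_a^\xi,b_c^\eta\},b_d^\epsilon]=(\epsilon-\xi)\delta_{ad}b_c^\eta+(\epsilon-\eta)\delta_{cd}b_a^\xi$ for $\xi,\eta,\epsilon\in\{+,-\}$ (read as $\pm1$ in algebraic expressions). The paraboson Fock space $V(\mathfrak{p})$ is the unitary irreducible representation (with $(b_a^\pm)^\dagger=b_a^\mp$) of lowest weight $(\frac{\mathfrak p}{2},\dots,\frac{\mathfrak p}{2})$, generated by a vacuum vector $|0\rangle$ with $b_a^-|0\rangle=0$ and $\{b_a^-,b_c^+\}|0\rangle=\mathfrak{p}\,\delta_{ac}|0\rangle$; it exists iff $\mathfrak p\in\{1,\dots,n-1\}$ or $\mathfrak p>n-1$. Its character (known) is $(x_1\cdots x_n)^{\mathfrak p/2}\sum_{\lambda,\ \ell(\lambda)\le\lceil\mathfrak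 p\rceil}s_\lambda(x_1,\dots,x_n)$, a sum of Schur functions, which are the characters of the $\mathfrak u(n)$ subalgebra spanned by the $\{b_a^+,b_c^-\}$. Here $n=6$ (two particles in three dimensions), and the index $a$ is a pair $(k,\alpha)$ with $k\in\{1,2,3\}$, $\alpha\in\{1,2\}$. The Hamiltonian is $\hat H=\frac{\hbar\omega}{2}\sum_{k,\alpha}\{b_{k,\alpha}^+,b_{k,\alpha}^-\}$ with constants $\hbar,\omega>0$. The total angular momentum operators are $M_j=\frac{-i\hbar}{2}\sum_{\alpha=1}^2\sum_{k,l=1}^3\epsilon_{jkl}\{b_{k,\alpha}^+,b_{l,\alpha}^-\}$ ($j=1,2,3$), with $\epsilon_{jkl}$ the Levi-Civita symbol; they satisfy $[M_i,M_j]=i\hbar\,\epsilon_{ijk}M_k$, span an $\mathfrak{so}(3)$ contained in $\mathfrak u(3)$ in the chain $\mathfrak u(6)\supset\mathfrak u(3)\oplus\mathfrak u(2)$ (from $\mathbb C^6=\mathbb C^3\otimes\mathbb C^2$), and commute with $\hat H$. *)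

(* Defs.v *)
From HB Require Import structures.
From mathcomp Require Import all_boot all_order all_algebra.
From mathcomp Require Import reals.
From mathcomp Require Import complex.

Set Implicit Arguments.
Unset Strict Implicit.
Unset Printing Implicit Defensive.

Import Order.TTheory GRing.Theory Num.Theory.
Local Open Scope ring_scope.
Local Open Scope complex_scope.

Section Operators.
Variables (F : fieldType) (V : lmodType F).

Definition comm_op (f g : V -> V) : V -> V := fun v => f (g v) - g (f v).

Definition anticomm_op (f g : V -> V) : V -> V := fun v => f (g v) + g (f v).

Definition eigenspace_op (f : V -> V) (a : F) : {pred V} :=
  [pred v | f v == a *: v].

(* [V] may be infinite dimensional, hence is not a [vectType]. *)
Definition has_dim (U : {pred V}) (d : nat) : Prop :=
  exists e : 'I_d -> V,
    (forall i, e i \in U) /\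
    (forall u, u \in U ->
       exists! c : {ffun 'I_d -> F}, u = \sum_(i < d) c i *: e i).

Definition stable_under (K : Type) (T : K -> V -> V) (U : {pred V}) : Prop :=
  forall k v, v \in U -> T k v \in U.

Definition irreducible_under (K : Type) (T : K -> V -> V) (U : {pred V}) :
    Prop :=
  [/\ submod_closed U,
      stable_under T U,
      exists2 u, u \in U & u != 0
    & forall W : {pred V},
        submod_closed W -> {subset W <= U} -> stable_under T W ->
        {subset W <= pred1 0} \/ {subset U <= W} ].

Definition direct_sum_of (r : nat) (U : 'I_r -> {pred V}) (W : {pred V}) :
    Prop :=
  forall w, w \in W <->
    exists! u : {ffun 'I_r -> V},
      (forall i, u i \in U i) /\ w = \sum_(i < r) u i.

(* [W] is a finite direct sum of finite-dimensional irreducible subspaces, and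
   exactly [k] of the summands have dimension [d].  For so(3) the dimension
   determines an irreducible representation up to isomorphism, so [k] is the
   multiplicity in [W] of the irreducible representation of dimension [d]. *)
Definition multiplicity_of_dim (K : Type) (T : K -> V -> V) (W : {pred V})
    (d k : nat) : Prop :=
  exists (r : nat) (U : 'I_r -> {pred V}) (dimU : 'I_r -> nat),
    [/\ forall i, irreducible_under T (U i),
        forall i, has_dim (U i) (dimU i),
        direct_sum_of U W
      & k = #|[pred i | dimU i == d]| ].

End Operators.

(* Signs: [true] is +, [false] is -, so [b true a] is b_a^+ and [b false a]
   is b_a^-. *)
Definition sgn (F : fieldType) (x : bool) : F := if x then 1 else -1.

Section Paraboson.
Variables (R : realType) (V : lmodType R[i]) (I : finType).
Implicit Type b : bool -> I -> {linear V -> V}.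

(* osp(1|2n), n = #|I|, is presented by the odd generators b_a^{+,-} and these
   relations (the superbracket of two odd elements is the anticommutator, that
   of an even and an odd element is the commutator); a representation is thus a
   family of operators satisfying them.  The Z/2-grading of V is not recorded:
   on a module generated by a vacuum it is the parity of the number of b_a^+. *)
Definition osp_representation b : Prop :=
  forall (x y e : bool) (a c d : I) (v : V),
    comm_op (anticomm_op (b x a) (b y c)) (b e d) v =
      ((sgn _ e - sgn _ x) * (a == d)%:R) *: b y c v
      + ((sgn _ e - sgn _ y) * (c == d)%:R) *: b x a v.

Definition unitary_rep (dot : {dot V for Num.conj}) b : Prop :=
  forall (x : bool) (a : I) (v w : V),
    dot (b x a v) w = dot v (b (~~ x) a w).

Definition all_ops b : bool * I -> V -> V := fun k => b k.1 k.2.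

Definition is_vacuum (p : R) b (vac : V) : Prop :=
  [/\ vac != 0,
      forall a, b false a vac = 0,
      forall a c,
        anticomm_op (b false a) (b true c) vac = (p%:C * (a == c)%:R) *: vac
    & forall W : {pred V},
        submod_closed W -> vac \in W -> stable_under (all_ops b) W ->
        forall v, v \in W ].

Definition paraboson_fock (p : R) (dot : {dot V for Num.conj}) b : Prop :=
  [/\ osp_representation b,
      unitary_rep dot b,
      irreducible_under (all_ops b) predT
    & exists vac, is_vacuum p b vac ].

Definition hamiltonian (hbar omega : R) b : V -> V :=
  fun v => (hbar * omega / 2)%:C *:
    \sum_(a : I) anticomm_op (b true a) (b false a) v.

End Paraboson.

(* Indices 1, 2, 3 are 0, 1, 2 : 'I_3, and addition in 'I_3 is modulo 3. *)
Definition levi_civita (j k l : 'I_3) : int :=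
  if (k == j + 1) && (l == j + 2) then 1
  else if (k == j + 2) && (l == j + 1) then -1
  else 0.

Definition angular_momentum (R : realType) (V : lmodType R[i])
    (hbar : R) (b : bool -> 'I_3 * 'I_2 -> {linear V -> V})
    (j : 'I_3) : V -> V :=
  fun v => (- 'i * hbar%:C / 2) *:
    \sum_(alpha < 2) \sum_(k < 3) \sum_(l < 3)
      (levi_civita j k l)%:~R *:
        anticomm_op (b true (k, alpha)) (b false (l, alpha)) v.

(* A formal power series in z over [A] is its coefficient sequence
   [nat -> A].  [G] is the quotient p / q when q is invertible in A[[z]]
   (i.e. its constant term is a unit) and G * q = p. *)
Definition is_series_quotient (A : comUnitRingType) (G : nat -> A)
    (p q : {poly A}) : Prop :=
  q`_0 \is a GRing.unit /\
  forall n, \sum_(i < n.+1) G i * q`_(n - i) = p`_n.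

(* [G] is the formal sum over E and j of m(E,j) z^E J^j.  For this to be a
   power series in z over Z[J], m must vanish off natural E, and each
   coefficient of z^n must be a polynomial in J. *)
Definition is_generating_series (m : rat -> nat -> nat)
    (G : nat -> {poly int}) : Prop :=
  (forall E j, E \isn't a Num.nat -> m E j = 0%N) /\
  (forall n j, (G n)`_j = (m n%:R j)%:Z).

Notation Jvar := (('X : {poly int})%:P) (only parsing).
Notation zvar := ('X : {poly {poly int}}) (only parsing).

(* Main.v *)
Require Import Defs.
From HB Require Import structures.
From mathcomp Require Import all_boot all_order all_algebra.
From mathcomp Require Import boolp reals.
From mathcomp Require Import complex.
From mathcomp Require Import ring zify.

Set Implicit Arguments.
Unset Strict Implicit.
Unset Printing Implicit Defensive.

Import Order.TTheory GRing.Theory Num.Theory.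
Local Open Scope ring_scope.

(** For p = 1 the osp(1|2n) relations together with positivity of the norm on
    the vacuum force the canonical commutation relations, so V(1) is the bosonic
    Fock space on C^3 (x) C^2 and the level of energy N + 3 is the space of
    polynomials of degree N in six variables.  In any decomposition into
    irreducibles of so(3) the number of summands of dimension 2j+1 is the
    difference of the dimensions of the L_0-weight spaces of weights j and j+1;
    a decomposition exists by unitarity.  The weight spaces have explicit bases
    of monomials in the circular creation operators b_1^+ +- i b_2^+, b_3^+, and
    counting them gives multiplicity (j+1) T(s) if N - j = 2s and j T(s) if
    N - j = 2s+1, where T(s) = (s+1)(s+2)/2 has generating function
    1/(1-x)^3. *)

(** * Finite families and orthogonality *)

(** The multiplicity predicate admits every decomposition into irreducibles, orthogonal or not, so
    existence and uniqueness of the count are separate matters: orthogonality produces one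
    decomposition, while in an arbitrary one each summand is identified with the string of a highest
    weight vector. As [V] is infinite dimensional, finiteness of a level enters in two elementary
    forms: a product of factors [L0 - r] that annihilates it, which yields eigenvectors, and a
    finite spanning family, which bounds orthogonal families. Only integral weights are counted; a
    summand of even dimension has none and drops out of every weight dimension. The fraction has a
    classical reading. Highest weight polynomials in two vectors r_1, r_2 are generated by the three
    invariants r_a.r_b (degree 2, spin 0), the highest components of r_1 and r_2 (degree 1, spin 1)
    and that of r_1 x r_2 (degree 2, spin 1), whose square is a polynomial in the others. Here the
    formula is obtained by counting. *)

Section FiniteFamilies.
Variables (F : fieldType) (V : lmodType F).

Definition lin_free (I : finType) (e : I -> V) : Prop :=
  forall c : I -> F, \sum_i c i *: e i = 0 -> forall i, c i = 0.

Definition spanned_by (J : finType) (f : J -> V) (v : V) : Prop :=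
  exists c : J -> F, v = \sum_j c j *: f j.

(** A vector in the left kernel of the coordinate matrix [A] is a linear relation among the [e i],
    so [A] has full row rank. This inequality does the work of dimension theory inside [V]. *)
Lemma lin_free_card (I J : finType) (e : I -> V) (f : J -> V) :
  lin_free e -> (forall i, spanned_by f (e i)) -> (#|I| <= #|J|)%N.
Proof.
move=> freee /fin_all_exists [c Ec].
pose A := \matrix_(i < #|I|, j < #|J|) c (enum_val i) (enum_val j).
suff rA : row_free A by move: (rank_leq_col A); rewrite (eqP rA).
rewrite -kermx_eq0; apply/eqP/row_matrixP => k; rewrite row0.
set u := row k _; have uA : u *m A = 0 by rewrite -row_mul mulmx_ker row0.
apply/rowP => i'; rewrite [RHS]mxE -(enum_valK i').
move: (enum_val i'); apply: (freee (fun i => u 0 (enum_rank i))).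
under eq_bigr => i0 _ do rewrite Ec scaler_sumr.
rewrite exchange_big big1 //= => j _.
under eq_bigr => i0 _ do rewrite scalerA.
rewrite -scaler_suml; have /rowP/(_ (enum_rank j)) := uA.
rewrite !mxE => uA0.
rewrite (_ : \sum_i0 _ = 0) ?scale0r // -[RHS]uA0.
rewrite (reindex (@enum_val _ I)) /=; last first.
  by exists enum_rank => x _; rewrite (enum_valK, enum_rankK).
by apply: eq_bigr => i0 _; rewrite enum_valK [A _ _]mxE enum_rankK.
Qed.

Lemma lin_free_eq (I : finType) (e : I -> V) (c c' : I -> F) :
  lin_free e -> \sum_i c i *: e i = \sum_i c' i *: e i -> c =1 c'.
Proof.
move=> freee /eqP; rewrite -subr_eq0 -sumrB => /eqP Ecc' i.
apply/eqP; rewrite -subr_eq0; apply/eqP.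
apply: (freee (fun i => c i - c' i)); rewrite -[RHS]Ecc'.
by apply: eq_bigr => j _; rewrite scalerBl.
Qed.

Lemma has_dim_free (U : {pred V}) d : submod_closed U -> has_dim U d ->
  exists e : 'I_d -> V,
    [/\ forall i, e i \in U, lin_free e & forall u, u \in U -> spanned_by e u].
Proof.
move=> [U0 _] [e [eU eb]]; exists e; split=> //; last first.
  by move=> u /eb[c [-> _]]; exists c.
move=> c c0 i; have [c1 [_ c1u]] := eb _ U0.
have <- : c1 i = c i by rewrite (c1u (finfun c)) ?ffunE //; under eq_bigr do rewrite ffunE.
rewrite (c1u 0) ?ffunE // big1 // => j _.
by rewrite ffunE scale0r.
Qed.

Lemma has_dim_card (U : {pred V}) d (I : finType) (e : I -> V) :
  submod_closed U -> has_dim U d ->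
  (forall i, e i \in U) -> lin_free e -> (forall u, u \in U -> spanned_by e u) ->
  d = #|I|.
Proof.
move=> subU /(has_dim_free subU)[f [fU ff fs]] eU ef es.
apply/eqP; rewrite eqn_leq -{1}[d]card_ord; apply/andP; split.
  by apply: (lin_free_card ff) => i; exact: es.
by rewrite -{1}(card_ord d); apply: (lin_free_card ef) => i; exact: fs.
Qed.

Lemma free_has_dim (U : {pred V}) d (e : 'I_d -> V) :
  (forall i, e i \in U) -> lin_free e -> (forall u, u \in U -> spanned_by e u) ->
  has_dim U d.
Proof.
move=> eU ef es; exists e; split=> // u /es[c Ec]; exists (finfun c); split.
  by rewrite Ec; apply: eq_bigr => i _; rewrite ffunE.
move=> c' Ec'; apply/ffunP => i; rewrite ffunE.
by apply: (lin_free_eq ef); rewrite -Ec -Ec'.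
Qed.

Lemma submod_sum (U : {pred V}) (I : Type) (s : seq I) (P : pred I) (f : I -> V) :
  submod_closed U -> (forall i, P i -> f i \in U) -> \sum_(i <- s | P i) f i \in U.
Proof.
move=> [U0 UD] fU; elim/big_ind: _ => // x y xU yU.
by rewrite -[x]scale1r UD.
Qed.

Lemma submodZ (U : {pred V}) a u : submod_closed U -> u \in U -> a *: u \in U.
Proof. by move=> [U0 UD] uU; rewrite -[_ *: _]addr0 UD. Qed.

Lemma submodD (U : {pred V}) u v :
  submod_closed U -> u \in U -> v \in U -> u + v \in U.
Proof. by move=> [U0 UD] uU vU; rewrite -[u]scale1r UD. Qed.

Lemma submodB (U : {pred V}) u v :
  submod_closed U -> u \in U -> v \in U -> u - v \in U.
Proof. by move=> sU uU vU; rewrite submodD // -scaleN1r submodZ. Qed.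

End FiniteFamilies.

Section Orthogonal.
Variables (C : numClosedFieldType) (V : lmodType C).
Variable dot : {dot V for Num.conj}.

(** The index type is arbitrary because the family of all monomials is infinite. *)
Definition orth_family (I : Type) (e : I -> V) : Prop :=
  (forall i, e i != 0) /\ (forall i j, i <> j -> dot (e i) (e j) = 0).

Lemma dot_sym0 u v : dot u v = 0 -> dot v u = 0.
Proof. by move/eqP; rewrite herm_eq0C => /eqP. Qed.

Lemma dotC u v : dot u v = (dot v u)^*.
Proof. by rewrite hermC expr0 mul1r. Qed.

Lemma dot_adj (f g : V -> V) : (forall u v, dot (f u) v = dot u (g v)) ->
  forall u v, dot (g u) v = dot u (f v).
Proof.
by move=> fg u v; rewrite dotC -fg -dotC.
Qed.

Lemma dot_orth_sum (I : finType) (e : I -> V) (c : I -> C) i : orth_family e ->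
  dot (\sum_j c j *: e j) (e i) = c i * dot (e i) (e i).
Proof.
move=> [_ eo]; rewrite linear_sumlz (bigD1 i) //= big1 ?addr0.
  by rewrite linearZl_LR.
by move=> j /eqP ji; rewrite linearZl_LR /= eo // mulr0.
Qed.

Lemma orth_free (I : finType) (e : I -> V) : orth_family e -> lin_free e.
Proof.
move=> eo c c0 i; have := dot_orth_sum c i eo; rewrite c0 linear0l.
move/esym/eqP; rewrite mulf_eq0 dnorm_eq0 (negPf (eo.1 i)) orbF.
by move/eqP.
Qed.

Lemma dot_eigen0 (L : V -> V) u v a b :
  (forall u v, dot (L u) v = dot u (L v)) -> L u = a *: u -> L v = b *: v ->
  b^* = b -> a != b -> dot u v = 0.
Proof.
move=> Ladj Lu Lv bR ab; have := Ladj u v.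
rewrite Lu Lv linearZl_LR linearZr_LR /= bR => /eqP.
by rewrite -subr_eq0 -mulrBl mulf_eq0 subr_eq0 (negPf ab) /= => /eqP.
Qed.

End Orthogonal.

(** * Representations of sl(2) *)

Section SL2.
Variables (C : numClosedFieldType) (V : lmodType C).
Variable dot : {dot V for Num.conj}.
Variables (L0 Lp Lm : {linear V -> V}).
Hypothesis L0p : forall v, L0 (Lp v) = Lp (L0 v) + Lp v.
Hypothesis L0m : forall v, L0 (Lm v) = Lm (L0 v) - Lm v.
Hypothesis Lpm : forall v, Lp (Lm v) = Lm (Lp v) + 2 *: L0 v.
Hypothesis L0_adj : forall u v, dot (L0 u) v = dot u (L0 v).
Hypothesis Lp_adj : forall u v, dot (Lp u) v = dot u (Lm v).

Definition sl2_stable (U : {pred V}) : Prop :=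
  forall u, u \in U -> [/\ L0 u \in U, Lp u \in U & Lm u \in U].

(** The product of the operators [L0 - r] applied to [v]. A list [rs] annihilating a subspace plays
    the role of a characteristic polynomial split into linear factors. *)
Definition char_prod (rs : seq C) (v : V) : V :=
  foldr (fun r v => L0 v - r *: v) v rs.

Lemma char_prod_eigen rs v a : L0 v = a *: v ->
  char_prod rs v = (\prod_(r <- rs) (a - r)) *: v.
Proof.
move=> L0v; elim: rs => [|r rs IH] /=; first by rewrite big_nil scale1r.
by rewrite IH linearZ /= L0v !scalerA -scalerBl big_cons mulrBl [_ * a]mulrC.
Qed.

Lemma char_prod_eigen0 rs v a : L0 v = a *: v -> v != 0 ->
  char_prod rs v = 0 -> a \in rs.
Proof.
move=> L0v v0; rewrite (char_prod_eigen _ L0v) => /eqP.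
rewrite scaler_eq0 (negPf v0) orbF prodf_seq_eq0 => /hasP[r rrs /=].
by rewrite subr_eq0 => /eqP->.
Qed.

Lemma char_prod_sum rs (I : Type) (s : seq I) (f : I -> V) (c : I -> C) :
  char_prod rs (\sum_(i <- s) c i *: f i) = \sum_(i <- s) c i *: char_prod rs (f i).
Proof.
elim: rs => [|r rs /= ->] //=.
rewrite linear_sum scaler_sumr -sumrB; apply: eq_bigr => i _ /=.
by rewrite linearZ /= scalerBr !scalerA [r * _]mulrC.
Qed.

Lemma char_prod_mem rs (U : {pred V}) u : submod_closed U -> sl2_stable U ->
  u \in U -> char_prod rs u \in U.
Proof.
move=> sU stU uU; elim: rs => //= r rs IH.
by apply: submodB => //; [case: (stU _ IH) | exact: submodZ].
Qed.

(** Among the partial products applied to [u], the last nonzero one is killed by the next factor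
    [L0 - r]. *)
Lemma exists_eigenvector (U : {pred V}) rs u : submod_closed U -> sl2_stable U ->
  u \in U -> u != 0 -> char_prod rs u = 0 ->
  exists v a, [/\ v \in U, v != 0 & L0 v = a *: v].
Proof.
move=> sU stU uU u0; elim: rs => [/= E|r rs IH /= Er].
  by rewrite E eqxx in u0.
have [E|E] := eqVneq (char_prod rs u) 0; first exact: IH.
exists (char_prod rs u), r; split=> //; first exact: char_prod_mem.
by apply/eqP; rewrite -subr_eq0 Er.
Qed.

Lemma L0_iter_Lp v a k : L0 v = a *: v ->
  L0 (iter k Lp v) = (a + k%:R) *: iter k Lp v.
Proof.
move=> L0v; elim: k => [|k IH] /=; first by rewrite addr0.
by rewrite L0p IH linearZ /= -[X in _ + X]scale1r -scalerDl -natr1 addrA.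
Qed.

Lemma L0_iter_Lm v a k : L0 v = a *: v ->
  L0 (iter k Lm v) = (a - k%:R) *: iter k Lm v.
Proof.
move=> L0v; elim: k => [|k IH] /=; first by rewrite subr0.
rewrite L0m IH linearZ /= -[X in _ - X]scale1r -scalerBl; congr (_ *: _).
by rewrite -natr1; ring.
Qed.

(** In characteristic zero the progression takes more distinct values than [rs] has entries. It is
    used with b = 1 and b = -1, the shifts of eigenvalue made by [Lp] and [Lm]: a string must vanish
    once it leaves the roots. *)
Lemma seq_escape (a b : C) (rs : seq C) : b != 0 -> exists k, a + b * k%:R \notin rs.
Proof.
move=> b0; apply: contrapT => noK.
have allin k : a + b * k%:R \in rs.
  by apply: contrapT => ak; apply: noK; exists k; apply/negP.
pose s := [seq a + b * k%:R | k <- iota 0 (size rs).+1].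
have : (size s <= size rs)%N.
  apply: uniq_leq_size; last by move=> _ /mapP[k _ ->].
  rewrite map_inj_uniq ?iota_uniq // => k l /addrI /(mulfI b0) /eqP.
  by rewrite eqr_nat => /eqP.
by rewrite size_map size_iota ltnn.
Qed.

Lemma iter_vanish (f : V -> V) (v : V) : v != 0 -> (exists k, iter k f v = 0) ->
  exists k, iter k f v != 0 /\ iter k.+1 f v = 0.
Proof.
move=> v0 ex0; have ex0' : exists k, iter k f v == 0 by case: ex0 => k /eqP; exists k.
case: (ex_minnP ex0') => -[|k] /eqP Ek mink; first by rewrite -Ek eqxx in v0.
by exists k; split=> //; apply/negP => /mink; rewrite ltnn.
Qed.

(* [n] is twice the weight: it is the dimension of the generated module minus 1. *)
Definition highest_weight (w : V) (n : nat) : Prop :=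
  [/\ w != 0, Lp w = 0, L0 w = (n%:R / 2) *: w & iter n.+1 Lm w = 0].

(** Moving [Lp] past each [Lm] contributes twice the weight met there: 2a + 2(a-1) + ... + 2(a-k) =
    (k+1)(2a-k). *)
Lemma Lp_iter_Lm w a k : Lp w = 0 -> L0 w = a *: w ->
  Lp (iter k.+1 Lm w) = (k.+1%:R * (2 * a - k%:R)) *: iter k Lm w.
Proof.
move=> Lpw L0w; elim: k => [|k IH].
  by rewrite /= Lpm Lpw linear0 add0r L0w scalerA subr0 mul1r.
rewrite iterS Lpm IH linearZ (L0_iter_Lm _ L0w) scalerA -iterS -scalerDl.
by congr (_ *: _); rewrite -!natr1; ring.
Qed.

(** An eigenvector is raised as long as it stays nonzero, which gives [w]; lowering [w] until it
    vanishes gives [n]. *)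
Lemma exists_highest_weight (U : {pred V}) rs u :
  submod_closed U -> sl2_stable U -> (forall v, v \in U -> char_prod rs v = 0) ->
  u \in U -> u != 0 -> exists w n, w \in U /\ highest_weight w n.
Proof.
move=> sU stU Uk uU u0.
have [v [a [vU v0 L0v]]] := exists_eigenvector sU stU uU u0 (Uk _ uU).
have [|k [w0 Lpw]] := iter_vanish (f := Lp) v0.
  have [k ak] := seq_escape a rs (oner_neq0 _); exists k.
  apply/eqP; apply: contraNT ak => vk; rewrite mul1r.
  apply: char_prod_eigen0 (L0_iter_Lp _ L0v) vk (Uk _ _).
  by elim: (k) => //= i /stU[].
set w := iter k Lp v in w0; have wU : w \in U by rewrite /w; elim: (k) => //= i /stU[].
have L0w := L0_iter_Lp k L0v; rewrite -/w in L0w; set b := a + _ in L0w.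
have [|n [wn Lmw]] := iter_vanish (f := Lm) w0.
  have N1_neq0 : -1 != 0 :> C by rewrite oppr_eq0 oner_eq0.
  have [i bi] := seq_escape b rs N1_neq0.
  exists i; apply/eqP; apply: contraNT (bi) => wi; rewrite mulN1r.
  apply: char_prod_eigen0 (L0_iter_Lm _ L0w) wi (Uk _ _).
  by elim: (i) => //= l /stU[].
exists w, n; split=> //; split=> //.
(* Since [Lm] applied n+1 times to [w] gives 0, the factor 2b - n must vanish: the weight b is half
   an integer. *)
have := Lp_iter_Lm n Lpw L0w; rewrite Lmw linear0 => /esym/eqP.
rewrite scaler_eq0 (negPf wn) orbF mulf_eq0 pnatr_eq0 /= subr_eq0 => /eqP <-.
by rewrite mulrC mulKf ?pnatr_eq0.
Qed.

(** * The irreducible module generated by a highest weight vector *)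

Section HighestWeight.
Variables (w : V) (n : nat).
Hypothesis hw : highest_weight w n.

Lemma hw_L0 k : L0 (iter k Lm w) = (n%:R / 2 - k%:R) *: iter k Lm w.
Proof. by case: hw => _ _ L0w _; exact: L0_iter_Lm. Qed.

Lemma hw_Lp k : Lp (iter k.+1 Lm w) = (k.+1%:R * (n%:R - k%:R)) *: iter k Lm w.
Proof.
case: hw => _ Lpw L0w _; rewrite (Lp_iter_Lm _ Lpw L0w).
by rewrite [2 * _]mulrC divfK ?pnatr_eq0.
Qed.

Lemma hw_neq0 k : (k <= n)%N -> iter k Lm w != 0.
Proof.
elim: k => [_|k IH kn]; first by case: hw.
apply/negP => /eqP E; have := hw_Lp k; rewrite E linear0 => /esym/eqP.
rewrite scaler_eq0 (negPf (IH (ltnW kn))) orbF mulf_eq0 pnatr_eq0 /=.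
by rewrite subr_eq0 eqr_nat gtn_eqF.
Qed.

Definition weight_string (k : 'I_n.+1) : V := iter k Lm w.

Lemma weight_string_orth : orth_family dot weight_string.
Proof.
split=> [k|k l kl]; first by apply: hw_neq0; rewrite -ltnS.
apply: dot_eigen0 L0_adj (hw_L0 _) (hw_L0 _) _ _.
  by rewrite rmorphB fmorph_div !rmorph_nat.
apply/eqP => /addrI/oppr_inj/eqP; rewrite eqr_nat => /eqP kl'.
by apply: kl; exact: val_inj.
Qed.

Definition string_space : {pred V} := [pred v | `[< spanned_by weight_string v >]].

Lemma string_spaceP v : reflect (spanned_by weight_string v) (v \in string_space).
Proof. exact: asboolP. Qed.

Lemma string_space_submod : submod_closed string_space.
Proof.
split; first by apply/string_spaceP; exists (fun=> 0); rewrite big1 // => i _; rewrite scale0r.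
move=> a u v /string_spaceP[c ->] /string_spaceP[c' ->]; apply/string_spaceP.
exists (fun i => a * c i + c' i); rewrite scaler_sumr -big_split /=.
by apply: eq_bigr => i _; rewrite scalerA scalerDl.
Qed.

Lemma weight_string_mem k : weight_string k \in string_space.
Proof.
apply/string_spaceP; exists (fun i => (i == k)%:R).
rewrite (bigD1 k) //= eqxx scale1r big1 ?addr0 // => i /negPf->.
by rewrite scale0r.
Qed.

Lemma iter_Lm_mem k : iter k Lm w \in string_space.
Proof.
have [kn|kn] := ltnP k n.+1; first exact: (weight_string_mem (Ordinal kn)).
rewrite -(subnK kn) iterD; have [_ _ _ ->] := hw.
rewrite (_ : iter _ _ _ = 0); first by case: string_space_submod.
by elim: (k - _)%N => //= i ->; rewrite linear0.
Qed.

Lemma string_space_stable : sl2_stable string_space.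
Proof.
have sS := string_space_submod.
move=> _ /string_spaceP[c ->]; rewrite !linear_sum; split; apply: submod_sum => // k _;
  rewrite linearZ; apply: submodZ => //=.
- by rewrite hw_L0; apply: submodZ => //; exact: iter_Lm_mem.
- rewrite /weight_string; case: k => -[|k] kn /=.
    by case: hw => _ -> _ _; case: sS.
  by rewrite -iterS hw_Lp; apply: submodZ => //; exact: iter_Lm_mem.
- exact: (iter_Lm_mem k.+1).
Qed.

Lemma string_space_min (U : {pred V}) : submod_closed U -> sl2_stable U ->
  w \in U -> {subset string_space <= U}.
Proof.
move=> sU stU wU _ /string_spaceP[c ->]; apply: submod_sum => // k _.
by apply: submodZ => //; rewrite /weight_string; elim: (nat_of_ord k) => //= i /stU[].
Qed.

(** [Lp] sends each vector of the string other than [w] to a nonzero multiple of its predecessor, so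
    a vector that it kills has only a coordinate along [w]. *)
Lemma string_space_Lp0 v : v \in string_space -> Lp v = 0 -> exists a, v = a *: w.
Proof.
move=> /string_spaceP[c Ev] Lpv; exists (c ord0).
rewrite Ev big_ord_recl big1 ?addr0 // => k _.
suff -> : c (lift ord0 k) = 0 by rewrite scale0r.
have kn := ltn_ord k.
(* [c' i] is the i-th coordinate of [Lp v]. For i = n the argument of [inord] is out of range, but
   the factor n - i is zero there. *)
pose c' (i : 'I_n.+1) := (i.+1%:R * (n%:R - i%:R)) * c (inord i.+1).
have : \sum_(i < n.+1) c' i *: weight_string i = 0.
  rewrite big_ord_recr /= /c' subrr mulr0 mul0r scale0r addr0.
  rewrite -[RHS]Lpv Ev linear_sum [RHS]big_ord_recl linearZ /= /weight_string /=.
  case: hw => _ -> _ _; rewrite scaler0 add0r; apply: eq_bigr => i _.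
  rewrite linearZ hw_Lp /= scalerA mulrC; congr (_ * _ *: _); congr c.
  by apply: val_inj; rewrite /= inordK // ltnS ltn_ord.
move/(orth_free weight_string_orth) => /(_ (widen_ord (leqnSn n) k)) /eqP.
rewrite /c' !mulf_eq0 pnatr_eq0 /= subr_eq0 eqr_nat gtn_eqF //= => /eqP <-.
by congr c; apply: val_inj; rewrite /= inordK.
Qed.

(** A nonzero stable subspace contains a highest weight vector, which inside the string can only be
    a multiple of [w], and [w] generates the string. *)
Lemma string_space_irr rs (W : {pred V}) u :
  (forall v, v \in string_space -> char_prod rs v = 0) ->
  submod_closed W -> {subset W <= string_space} -> sl2_stable W ->
  u \in W -> u != 0 -> {subset string_space <= W}.
Proof.
move=> kS sW WS stW uW u0.
have kW v (vW : v \in W) : char_prod rs v = 0 by exact/kS/WS.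
have [w' [n' [w'W [w'0 Lpw' _ _]]]] := exists_highest_weight sW stW kW uW u0.
have [a Ew'] := string_space_Lp0 (WS _ w'W) Lpw'.
apply: string_space_min => //.
have a0 : a != 0 by apply: contraNneq w'0 => a0; rewrite Ew' a0 scale0r.
by rewrite -[w](scalerK a0) -Ew'; exact: submodZ.
Qed.

Lemma string_space_has_dim : has_dim string_space n.+1.
Proof.
apply: (free_has_dim weight_string_mem (orth_free weight_string_orth)).
by move=> u /string_spaceP.
Qed.

End HighestWeight.

(* Moving one [Lm] across the product turns it into [Lp], which lowers both
   exponents. *)
Lemma string_orth w n w' n' k l : highest_weight w n -> highest_weight w' n' ->
  dot w w' = 0 -> dot (iter k Lm w) (iter l Lm w') = 0.
Proof.
move=> hw hw' ww'; elim: k l => [|k IH] [|l] //.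
- by rewrite [iter l.+1 _ _]iterS -Lp_adj /=; case: hw => _ -> _ _; rewrite linear0l.
- rewrite iterS (dot_adj Lp_adj) /=; case: hw' => _ -> _ _; rewrite linear0r //.
- by rewrite iterS (dot_adj Lp_adj) (hw_Lp hw') linearZr_LR /= IH mulr0.
Qed.

Lemma string_space_dot0 w n w' n' u v :
  highest_weight w n -> highest_weight w' n' -> dot w w' = 0 ->
  u \in string_space w n -> v \in string_space w' n' -> dot u v = 0.
Proof.
move=> hw hw' ww' /string_spaceP[c ->] /string_spaceP[c' ->].
rewrite linear_sumlz big1 // => k _; rewrite linearZl_LR /=.
rewrite linear_sumr big1 ?mulr0 // => l _.
by rewrite linearZr_LR /= (string_orth _ _ hw hw' ww') mulr0.
Qed.

(** The string has weights n/2 - k, each on a line, so the integral weight m occurs only for even n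
    with 2m <= n, at k = n/2 - m. *)
Lemma string_space_weight w n m u : highest_weight w n ->
  u \in string_space w n -> L0 u = m%:R *: u ->
  exists c, u = c *: (if ~~ odd n && (2 * m <= n)%N then iter (n./2 - m) Lm w else 0).
Proof.
move=> hw /string_spaceP[c Eu] L0u.
have c0 (k : 'I_n.+1) : n <> (2 * (m + k))%N -> c k = 0.
  move=> nk; pose c' (i : 'I_n.+1) := c i * (n%:R / 2 - i%:R - m%:R).
  have : \sum_i c' i *: weight_string w i = 0.
    transitivity (L0 u - m%:R *: u); last by rewrite L0u subrr.
    rewrite Eu linear_sum scaler_sumr -sumrB; apply: eq_bigr => i _.
    rewrite linearZ /= (hw_L0 hw) !scalerA -scalerBl; congr (_ *: _).
    by rewrite /c'; ring.
  move/(orth_free (weight_string_orth hw))/(_ k)/eqP.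
  rewrite mulf_eq0 => /orP[/eqP //|/eqP E]; case: nk.
  apply/eqP; rewrite -(eqr_nat C) natrM natrD -subr_eq0.
  rewrite -(mulfK (_ : 2 != 0 :> C) n%:R) ?pnatr_eq0 //.
  rewrite -[X in _ == X](mulr0 2) -E; apply/eqP; ring.
have [/andP[on mn]|nD] := ifP; last first.
  exists 0; rewrite scale0r Eu big1 // => k _; rewrite c0 ?scale0r // => nk.
  by move: nD; rewrite nk mul2n odd_double -mul2n /= leq_mul2l leq_addr.
have kn : (n./2 - m < n.+1)%N by lia.
exists (c (Ordinal kn)); rewrite Eu (bigD1 (Ordinal kn)) //= big1 ?addr0 // => k kk.
rewrite c0 ?scale0r // => nk; move: kk; rewrite -val_eqE /= => /eqP; apply.
by lia.
Qed.

Lemma hw_L0_half w n m : highest_weight w n -> ~~ odd n && (2 * m <= n)%N ->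
  L0 (iter (n./2 - m) Lm w) = m%:R *: iter (n./2 - m) Lm w.
Proof.
move=> hw /andP[on mn]; rewrite (hw_L0 hw); congr (_ *: _).
rewrite -{1}(even_halfK on) -mul2n natrM mulrAC divff ?pnatr_eq0 // mul1r.
by rewrite -natrB; [congr _%:R; lia | lia].
Qed.

(** * Orthogonal decomposition of a finitely spanned stable subspace *)

Section CompleteReducibility.
Variables (W : {pred V}) (rs : seq C) (J : finType) (f : J -> V).
Hypotheses (subW : submod_closed W) (stW : sl2_stable W).
Hypothesis kW : forall v, v \in W -> char_prod rs v = 0.
Hypothesis fW : forall v, v \in W -> spanned_by f v.

Definition hw_family r (w : 'I_r -> V) (n : 'I_r -> nat) : Prop :=
  [/\ forall i, w i \in W, forall i, highest_weight (w i) (n i)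
    & forall i j, i <> j -> dot (w i) (w j) = 0].

Lemma hw_family_size r w n : @hw_family r w n -> (r <= #|J|)%N.
Proof.
move=> [wW hw wo]; rewrite -[X in (X <= _)%N](card_ord r).
apply: (@lin_free_card _ _ _ _ w f); last by move=> i; exact/fW/wW.
by apply: (orth_free (dot := dot)); split=> // i; case: (hw i).
Qed.

Lemma hw_family_rcons r w n w0 n0 : @hw_family r w n ->
  w0 \in W -> highest_weight w0 n0 -> (forall i, dot w0 (w i) = 0) ->
  exists w' n', @hw_family r.+1 w' n'.
Proof.
move=> [wW hw wo] w0W hw0 w0o.
exists (fun i => oapp w w0 (unlift ord0 i)), (fun i => oapp n n0 (unlift ord0 i)).
split=> [i|i|i j].
- by case: unliftP => [i'|] _ /=.
- by case: unliftP => [i'|] _ /=.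
case: unliftP => [i'|] Ei; case: unliftP => [j'|] Ej ij /=; last by rewrite Ei Ej in ij.
- by apply: wo => ij'; apply: ij; rewrite Ei Ej ij'.
- exact/dot_sym0/w0o.
- exact: w0o.
Qed.

Lemma exists_max_hw_family : exists r w n, @hw_family r w n /\
  forall w0 n0, w0 \in W -> highest_weight w0 n0 -> ~ (forall i, dot w0 (w i) = 0).
Proof.
pose P r := `[< exists w n, @hw_family r w n >].
have P0 : exists r, P r.
  exists 0%N; apply/asboolP; exists (fun=> 0), (fun=> 0%N).
  by split=> -[].
have Pmax r : P r -> (r <= #|J|)%N.
  by move=> /asboolP[w [n]]; exact: hw_family_size.
case: (ex_maxnP P0 Pmax) => r /asboolP[w [n fam]] maxr.
exists r, w, n; split=> // w0 n0 w0W hw0 w0o.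
have := hw_family_rcons fam w0W hw0 w0o; move/asboolP/maxr.
by rewrite ltnn.
Qed.

(* The vectors orthogonal to all strings of a maximal family of orthogonal
   highest weight vectors form a stable subspace, which by maximality has no
   highest weight vector and hence is zero. *)
Lemma complete_reducibility : exists r w n, @hw_family r w n /\
  direct_sum_of (fun i => string_space (w i) (n i)) W.
Proof.
have [r [w [n [fam famax]]]] := exists_max_hw_family; have [wW hw wo] := fam.
exists r, w, n; split=> //.
pose vec (x : {i : 'I_r & 'I_(n i).+1}) := weight_string (w (tag x)) (tagged x).
have vecW x : vec x \in W.
  by rewrite /vec /weight_string; elim: (nat_of_ord _) => //= k /stW[].
have veco : orth_family dot vec.
  split=> [x|[i k] [j l] /= xy]; first exact: (weight_string_orth (hw (tag x))).1.
  have [ij|/eqP ij] := eqVneq i j; last first.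
    by rewrite /vec (string_orth _ _ (hw i) (hw j)) ?wo.
  move: l xy; rewrite -ij => l xy.
  by apply: (weight_string_orth (hw i)).2 => kl; apply: xy; move: kl => /= ->.
pose K : {pred V} := [pred u | (u \in W) && `[< forall x, dot u (vec x) = 0 >]].
have KP u : reflect (u \in W /\ forall i k, dot u (iter k Lm (w i)) = 0) (u \in K).
  apply: (iffP andP) => [[uW /asboolP ou]|[uW ou]]; split=> //.
    move=> i k; have [kn|kn] := ltnP k (n i).+1.
      exact: (ou (Tagged _ (Ordinal kn : 'I_(n i).+1))).
    rewrite -(subnK kn) iterD; have [_ _ _ ->] := hw i.
    rewrite (_ : iter _ _ _ = 0) ?linear0r //.
    by elim: (k - _)%N => //= l ->; rewrite linear0.
  by apply/asboolP => x; exact: ou.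
have subK : submod_closed K.
  split; first by apply/KP; split=> [|i k]; [case: subW | rewrite linear0l].
  move=> a u v /KP[uW uo] /KP[vW vo]; apply/KP; split; first by case: subW => _; apply.
  by move=> i k; rewrite linearDl linearZl_LR /= uo vo mulr0 addr0.
have stK : sl2_stable K.
  move=> u /KP[uW uo]; have [L0uW LpuW LmuW] := stW uW.
  split; apply/KP; split=> // i k.
  - by rewrite L0_adj (hw_L0 (hw i)) linearZr_LR /= uo mulr0.
  - by rewrite Lp_adj -iterS uo.
  - rewrite (dot_adj Lp_adj); case: k => [|k].
      by rewrite /=; case: (hw i) => _ -> _ _; rewrite linear0r.
    by rewrite (hw_Lp (hw i)) linearZr_LR /= uo mulr0.
have K0 u : u \in K -> u = 0.
  move=> uK; apply/eqP; apply: contraT => u0.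
  have kK v (vK : v \in K) : char_prod rs v = 0 by apply: kW; case/KP: vK.
  have [w0 [n0 [/KP[w0W w0o] hw0]]] := exists_highest_weight subK stK kK uK u0.
  by case: (famax w0 n0 w0W hw0) => i; exact: (w0o i 0%N).
have span u : u \in W -> exists c, u = \sum_x c x *: vec x.
  move=> uW; pose c x := dot u (vec x) / dot (vec x) (vec x); exists c.
  apply/eqP; rewrite -subr_eq0; apply/eqP/K0/andP; split.
    by apply: submodB => //; apply: submod_sum => // x _; exact: submodZ.
  apply/asboolP => x; rewrite linearBl /= (dot_orth_sum c x veco) /c divfK ?subrr //.
  by rewrite dnorm_eq0; case: veco.
move=> u; split=> [uW|[v [[vS ->] _]]]; last first.
  apply: submod_sum => // i _; apply: (string_space_min subW stW (wW i)).
  exact: vS.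
have [c Eu] := span u uW.
pose v0 := [ffun i => \sum_(k < (n i).+1)
  c (existT (fun i => 'I_(n i).+1) i k) *: weight_string (w i) k].
have v0S i : v0 i \in string_space (w i) (n i).
  rewrite ffunE; apply/string_spaceP.
  by exists (fun k => c (existT (fun i => 'I_(n i).+1) i k)).
have Ev0 : u = \sum_i v0 i.
  rewrite Eu; under [RHS]eq_bigr do rewrite ffunE.
  rewrite (sig_big_dep _ _ (fun i k =>
    c (existT (fun i => 'I_(n i).+1) i k) *: weight_string (w i) k)) /=.
  by apply: eq_bigr => -[].
exists v0; split=> // v [vS Ev].
(* Different strings are orthogonal, so the squared norm of the difference [z i] of the i-th
   components is its product with [\sum_l z l], which is 0. *)
apply/ffunP => i; apply/eqP; rewrite -subr_eq0 -(dnorm_eq0 dot); apply/eqP.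
pose z i := v0 i - v i; rewrite -/(z i).
have zS l : z l \in string_space (w l) (n l).
  by apply: submodB => //; exact: string_space_submod.
have z0 : \sum_l z l = 0 by rewrite sumrB -Ev -Ev0 subrr.
transitivity (dot (z i) (\sum_l z l)); last by rewrite z0 linear0r.
rewrite linear_sumr (bigD1 i) //= big1 ?addr0 // => l /eqP li.
by apply: (string_space_dot0 (hw i) (hw l) _ (zS i) (zS l)); apply: wo => il; exact: li.
Qed.

(** * Multiplicities read off from weight spaces *)

Section Multiplicity.
Variables (X : Type) (T : X -> V -> V).
Hypothesis stT : forall U : {pred V}, submod_closed U ->
  stable_under T U <-> sl2_stable U.

(** [T] enters the multiplicity only through its stable subspaces, which by [stT] are those of the
    sl(2) triple; hence the string spaces are irreducible for [T] as well. *)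
Lemma multiplicity_exists d : exists k, multiplicity_of_dim T W d k.
Proof.
have [r [w [n [[wW hw wo] dW]]]] := complete_reducibility.
pose U i := string_space (w i) (n i).
have subU i : submod_closed (U i) by exact: string_space_submod.
have stU i : sl2_stable (U i) by exact: string_space_stable.
exists #|[pred i | (n i).+1 == d]|, r, U, (fun i => (n i).+1); split=> // i; last first.
  exact: string_space_has_dim.
have UW : {subset U i <= W} by exact: string_space_min.
split=> //; first exact/stT.
- exists (w i); last by case: (hw i).
  exact: (iter_Lm_mem (hw i) 0).
move=> Z subZ ZU /(stT subZ) stZ.
have [[u [uZ u0]]|noZ] := pselect (exists u, u \in Z /\ u != 0).
  right; apply: (string_space_irr (hw i) (rs := rs)) uZ u0 => //.
  by move=> v /UW/kW.
left=> u uZ; rewrite inE; apply: contraT => u0; case: noZ; by exists u.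
Qed.

Lemma direct_sum_of_eq0 r (U : 'I_r -> {pred V}) (u : 'I_r -> V) :
  (forall i, submod_closed (U i)) -> direct_sum_of U W ->
  (forall i, u i \in U i) -> \sum_i u i = 0 -> forall i, u i = 0.
Proof.
move=> subU dU uU u0 i; have [W0 _] := subW.
have [v [_ vu]] := (dU 0).1 W0.
have -> : u i = v i.
  rewrite (vu (finfun u)) ?ffunE //; split; first by move=> l; rewrite ffunE.
  by rewrite -[LHS]u0; apply: eq_bigr => l _; rewrite ffunE.
rewrite (vu 0) ?ffunE //; split; first by move=> l; rewrite ffunE; case: (subU l).
by rewrite big1 // => l _; rewrite ffunE.
Qed.

(** [direct_sum_of] makes membership in [W] depend on a unique decomposition; uniqueness is
    transported from that of 0 by subtraction. *)
Lemma direct_sum_of_sub r (U : 'I_r -> {pred V}) i :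
  (forall i, submod_closed (U i)) -> direct_sum_of U W -> {subset U i <= W}.
Proof.
move=> subU dU u uU; apply/dU.
pose v l := if l == i then u else 0.
have vU l : v l \in U l.
  by rewrite /v; case: eqP => [->//|_]; case: (subU l).
have Ev : u = \sum_l v l.
  rewrite (bigD1 i) //= /v eqxx big1 ?addr0 // => l /negPf-> //.
exists (finfun v); split; first split.
- by move=> l; rewrite ffunE.
- by rewrite {1}Ev; apply: eq_bigr => l _; rewrite ffunE.
move=> v' [v'U Ev']; apply/ffunP => l; rewrite ffunE; apply/eqP.
rewrite -subr_eq0; apply/eqP.
apply: (direct_sum_of_eq0 (u := fun l => v l - v' l) subU dU).
  by move=> l'; exact: submodB.
by rewrite sumrB -Ev -Ev' subrr.
Qed.

Definition weight_basis (m : nat) (I : finType) (e : I -> V) : Prop :=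
  [/\ lin_free e, forall i, e i \in W, forall i, L0 (e i) = m%:R *: e i
    & forall u, u \in W -> L0 u = m%:R *: u -> spanned_by e u].

Lemma weight_basis_card m (I I' : finType) (e : I -> V) (e' : I' -> V) :
  weight_basis m e -> weight_basis m e' -> #|I| = #|I'|.
Proof.
move=> [ef eW eL es] [ef' eW' eL' es']; apply/eqP; rewrite eqn_leq.
by apply/andP; split;
  [apply: (lin_free_card ef) => i; apply: es' | apply: (lin_free_card ef') => i; apply: es].
Qed.

(* The weight space of weight [m] meets exactly the odd-dimensional summands of
   dimension at least [2m+1], each in a line. *)
Lemma multiplicity_unique (a : nat -> nat) j k :
  (forall m, exists (I : finType) (e : I -> V), #|I| = a m /\ weight_basis m e) ->
  multiplicity_of_dim T W (2 * j + 1) k -> (k + a j.+1 = a j)%N.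
Proof.
move=> Ha [r [U [dimU [irrU dU sumU ->]]]].
have subU i : submod_closed (U i) by case: (irrU i).
have stU i : sl2_stable (U i) by case: (irrU i) => _ /(stT (subU i)).
have UW i : {subset U i <= W} by exact: direct_sum_of_sub.
have ex_wn i : exists x : V * nat, x.1 \in U i /\ highest_weight x.1 x.2.
  have [_ _ [u uU u0] _] := irrU i.
  have kU v (vU : v \in U i) : char_prod rs v = 0 by exact/kW/(UW i).
  have [w [n [wU hw]]] := exists_highest_weight (subU i) (stU i) kU uU u0.
  by exists (w, n).
have {ex_wn}[wn wnP] := fin_all_exists ex_wn.
pose w i := (wn i).1; pose n i := (wn i).2.
have wU i : w i \in U i by case: (wnP i).
have hw i : highest_weight (w i) (n i) by case: (wnP i).
(* Irreducibility of [U i] is applied to the string of its own highest weight vector, a nonzero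
   stable subspace of it. *)
have US i : {subset U i <= string_space (w i) (n i)}.
  have [_ _ _ /(_ (string_space (w i) (n i)))[]//] := irrU i.
  - exact: string_space_submod.
  - by apply: string_space_min.
  - by apply/stT; [exact: string_space_submod | exact: string_space_stable].
  move=> S0; have := S0 _ (iter_Lm_mem (hw i) 0).
  by rewrite inE /=; case: (hw i) => /negPf->.
have SU i : {subset string_space (w i) (n i) <= U i} by apply: string_space_min.
have En i : dimU i = (n i).+1.
  have [eo] := weight_string_orth (hw i) => _.
  rewrite (has_dim_card (e := @weight_string (w i) (n i)) (subU i) (dU i)) ?card_ord //.
  - by move=> l; exact/SU/weight_string_mem.
  - exact/(orth_free (weight_string_orth (hw i))).
  - by move=> u /US/string_spaceP.
pose D m := [pred i | ~~ odd (n i) && (2 * m <= n i)%N].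
have cardD m : #|D m| = a m.
  have [I [e [<- eb]]] := Ha m.
  pose v i := iter ((n i)./2 - m) Lm (w i).
  have vU i : v i \in U i by exact/SU/iter_Lm_mem.
  rewrite -[LHS]card_ord.
  apply: (weight_basis_card (e := fun l : 'I_#|D m| => v (enum_val l))) eb.
  split.
  - move=> c c0 l.
    pose u i := \sum_(l | enum_val l == i) c l *: v i.
    have uU i : u i \in U i by apply: submod_sum => // y _; exact: submodZ.
    have u0 : \sum_i u i = 0.
      rewrite -[RHS]c0 [RHS](partition_big enum_val predT) //=.
      by apply: eq_bigr => i _; apply: eq_bigr => x /eqP->.
    have /eqP := direct_sum_of_eq0 subU sumU uU u0 (enum_val l).
    rewrite /u (eq_bigl (pred1 l)) => [|x]; last by rewrite (inj_eq enum_val_inj).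
    rewrite big_pred1_eq scaler_eq0 => /orP[/eqP//|].
    have := enum_valP l; rewrite inE => /andP[_ mn].
    by rewrite (negPf (hw_neq0 (hw _) _)) //; lia.
  - by move=> l; exact/UW/vU.
  - by move=> l; apply: hw_L0_half => //; have := enum_valP l; rewrite inE.
  move=> u uW L0u; have [x [[xU Eu] _]] := (sumU u).1 uW.
  have L0x i : L0 (x i) = m%:R *: x i.
    apply/eqP; rewrite -subr_eq0; apply/eqP; move: i.
    apply: (direct_sum_of_eq0 subU sumU) => [i|].
      by apply: submodB => //; [case: (stU i _ (xU i)) | exact: submodZ].
    by rewrite sumrB -linear_sum -scaler_sumr -Eu L0u subrr.
  have /fin_all_exists[c Ec] i :
      exists c, x i = c *: (if ~~ odd (n i) && (2 * m <= n i)%N then v i else 0).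
    exact: (string_space_weight (hw i) (US _ _ (xU i)) (L0x i)).
  exists (fun l => c (enum_val l)); rewrite Eu.
  rewrite -(big_enum_val (A := D m) (fun i => c i *: v i)) /= [RHS]big_mkcond /=.
  apply: eq_bigr => i _; rewrite Ec inE; case: ifP => //.
  by rewrite scaler0.
(* As [n i] is even on [D j], removing [D j.+1] from [D j] leaves exactly the i with [n i] = 2j, the
   summands of dimension 2j+1. *)
rewrite -!cardD -(cardID [pred i | n i == (2 * j)%N] (D j)); congr (_ + _)%N.
  by apply: eq_card => i; rewrite !inE En; lia.
by apply: eq_card => i; rewrite !inE; lia.
Qed.

End Multiplicity.
End CompleteReducibility.

End SL2.

(** * Bosonic Fock space *)

Section Bosons.
Variables (C : numClosedFieldType) (V : lmodType C).
Variable dot : {dot V for Num.conj}.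

Definition boson_ccr (G : finType) (cr an : G -> {linear V -> V}) : Prop :=
  [/\ forall g h v, cr g (cr h v) = cr h (cr g v),
      forall g h v, an g (an h v) = an h (an g v)
    & forall g h v, an g (cr h v) = cr h (an g v) + (g == h)%:R *: v].

Section Monomials.
Variables (G : finType) (cr an : G -> {linear V -> V}) (s : G -> C) (vac : V).
Hypothesis ccr : boson_ccr cr an.
Hypothesis s_gt0 : forall g, 0 < s g.
Hypothesis cr_adj : forall g u v, dot (cr g u) v = s g * dot u (an g v).
Hypotheses (vac0 : vac != 0) (an_vac : forall g, an g vac = 0).

Implicit Type x : {ffun G -> nat}.

Definition monomial x : V := foldr (fun g v => iter (x g) (cr g) v) vac (enum G).

Definition incr_mode x h : {ffun G -> nat} := [ffun g => (x g + (g == h))%N].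
Definition decr_mode x h : {ffun G -> nat} := [ffun g => (x g - (g == h))%N].

(** The canonical relations give |cr v|^2 = s (|v|^2 + s |an v|^2) for the mode g, with s = [s g] >
    0. *)
Lemma cr_inj g v : cr g v = 0 -> v = 0.
Proof.
move=> crv; apply/eqP; rewrite -(dnorm_eq0 dot).
have [_ _ anC] := ccr.
have := cr_adj g v (cr g v); rewrite crv linear0l => /esym/eqP.
rewrite mulf_eq0 gt_eqF //= -crv anC eqxx scale1r linearDr /=.
rewrite [dot v (cr _ _)]dotC cr_adj rmorphM /= -dotC.
rewrite (conj_Creal (gtr0_real (s_gt0 g))) paddr_eq0 ?dnorm_ge0 //.
  by case/andP.
by rewrite mulr_ge0 ?dnorm_ge0 // ltW.
Qed.

Lemma monomial_neq0 x : monomial x != 0.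
Proof.
rewrite /monomial; elim: (enum G) => //= g t IH.
by elim: (x g) => //= k; apply: contra => /eqP/cr_inj/eqP.
Qed.

Lemma number_cr g h v :
  cr h (an h (cr g v)) = cr g (cr h (an h v)) + (g == h)%:R *: cr g v.
Proof.
have [crC _ anC] := ccr; rewrite anC linearD linearZ /= crC eq_sym.
by case: eqP => [->//|]; rewrite !scale0r.
Qed.

Lemma number_monomial h x : cr h (an h (monomial x)) = (x h)%:R *: monomial x.
Proof.
rewrite /monomial; set t := enum G.
have : cr h (an h (foldr (fun g v => iter (x g) (cr g) v) vac t)) =
   (\sum_(g <- t) (g == h) * x g)%:R *: foldr (fun g v => iter (x g) (cr g) v) vac t.
  elim: t => [|g t IH] /=; first by rewrite big_nil scale0r an_vac linear0.
  rewrite big_cons; elim: (x g) => [|k IHk] /=; first by rewrite muln0.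
  rewrite number_cr IHk linearZ /= -scalerDl -natrD; congr (_%:R *: _).
  by move: (nat_of_bool _) (\sum_(_ <- _) _)%N => c d; rewrite mulnSr addnAC.
move=> ->; congr (_%:R *: _); rewrite /t big_enum /= (bigD1 h) //= eqxx mul1n.
by rewrite big1 ?addn0 // => g /negPf->.
Qed.

Lemma cr_monomial h x : cr h (monomial x) = monomial (incr_mode x h).
Proof.
have [crC _ _] := ccr.
have crI k g v : cr h (iter k (cr g) v) = iter k (cr g) (cr h v).
  by elim: k => //= k IH; rewrite crC IH.
rewrite /monomial; have : h \in enum G by rewrite mem_enum.
elim: (enum G) (enum_uniq G) => //= g t IH /andP[gt ut].
rewrite inE ffunE; have [hg _|hg /= ht] := eqVneq h g; last first.
  by rewrite addn0 crI IH.
rewrite -hg {g IH ut hg} in gt *; rewrite -iterS addn1; congr (iter _ _ _).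
elim: t gt => //= g' t IH; rewrite inE negb_or ffunE => /andP[hg' ht].
by rewrite IH // [g' == h]eq_sym (negPf hg') addn0.
Qed.

(** If x h = 0, the number operator kills the monomial, so by adjointness its image under [an h] has
    norm 0; the truncated subtraction in [decr_mode] is then met by the coefficient 0. *)
Lemma an_monomial h x :
  an h (monomial x) = (x h)%:R *: monomial (decr_mode x h).
Proof.
case xh: (x h) => [|k].
  rewrite scale0r; apply/eqP; rewrite -(dnorm_eq0 dot).
  have := cr_adj h (an h (monomial x)) (monomial x).
  rewrite number_monomial xh scale0r linear0l => /esym/eqP.
  by rewrite mulf_eq0 gt_eqF.
have [_ _ anC] := ccr.
have {1}-> : x = incr_mode (decr_mode x h) h.
  by apply/ffunP => g; rewrite !ffunE; case: eqP => [->|]; lia.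
rewrite -cr_monomial anC number_monomial eqxx -scalerDl -natr1 ffunE eqxx xh.
by rewrite subn1.
Qed.

(** Distinct exponents are separated by the number operator of some mode, which is self-adjoint
    because [s g] is real. *)
Lemma monomial_orth : orth_family dot monomial.
Proof.
split=> [x|x y xy]; first exact: monomial_neq0.
have /forallPn/=[g xyg] : ~~ [forall g, x g == y g].
  by apply/negP => /forallP xyg; apply: xy; apply/ffunP => g; apply/eqP.
apply: (dot_eigen0 (L := fun v => cr g (an g v)) _ (number_monomial g x)
  (number_monomial g y)).
- move=> u v; rewrite cr_adj -[RHS]/(dot u _) [RHS]dotC cr_adj rmorphM /= -dotC.
  by rewrite (conj_Creal (gtr0_real (s_gt0 g))).
- by rewrite rmorph_nat.
- by rewrite eqr_nat.
Qed.

Hypothesis vac_gen : forall U : {pred V}, submod_closed U -> vac \in U ->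
  (forall g u, u \in U -> cr g u \in U /\ an g u \in U) -> forall v, v \in U.

Lemma monomial_span v :
  exists t : seq (C * {ffun G -> nat}), v = \sum_(y <- t) y.1 *: monomial y.2.
Proof.
pose U : {pred V} := [pred v | `[< exists t : seq (C * {ffun G -> nat}),
  v = \sum_(y <- t) y.1 *: monomial y.2 >]].
suff /asboolP : v \in U by [].
apply: vac_gen.
- split; first by apply/asboolP; exists [::]; rewrite big_nil.
  move=> a _ _ /asboolP[t ->] /asboolP[t' ->]; apply/asboolP.
  exists ([seq (a * y.1, y.2) | y <- t] ++ t').
  rewrite big_cat big_map scaler_sumr; congr (_ + _).
  by apply: eq_bigr => y _; rewrite scalerA.
- apply/asboolP; exists [:: (1, [ffun=> 0%N])].
  rewrite big_seq1 scale1r /monomial /=.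
  by elim: (enum G) => //= g t <-; rewrite ffunE.
- move=> g _ /asboolP[t ->]; split; apply/asboolP.
    exists [seq (y.1, incr_mode y.2 g) | y : C * {ffun G -> nat} <- t].
    rewrite big_map linear_sum.
    by apply: eq_bigr => y _; rewrite linearZ /= cr_monomial.
  exists [seq (y.1 * (y.2 g)%:R, decr_mode y.2 g) | y : C * {ffun G -> nat} <- t].
  rewrite big_map linear_sum.
  by apply: eq_bigr => y _; rewrite linearZ /= an_monomial scalerA.
Qed.

(** Subtracting the orthogonal projection leaves a vector orthogonal to every monomial, hence to
    itself by [monomial_span]. *)
Lemma monomial_expand (I : finType) (e : I -> {ffun G -> nat}) v :
  injective e -> (forall y, (forall i, e i <> y) -> dot v (monomial y) = 0) ->
  spanned_by (fun i => monomial (e i)) v.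
Proof.
move=> inje vy; pose c i := dot v (monomial (e i)) / dot (monomial (e i)) (monomial (e i)).
have [m0 mo] := monomial_orth.
have eo : orth_family dot (fun i => monomial (e i)).
  by split=> // i j ij; apply: mo => /inje.
exists c; apply/eqP; rewrite -subr_eq0; set u := _ - _.
have uo y : dot u (monomial y) = 0.
  rewrite linearBl /=; have [[i <-]|noi] := pselect (exists i, e i = y).
    by rewrite (dot_orth_sum c i eo) divfK ?subrr // dnorm_eq0.
  rewrite vy; last by move=> i ei; apply: noi; exists i.
  rewrite linear_sumlz big1 ?subrr // => i _; rewrite linearZl_LR /= mo ?mulr0 //.
  by move=> ei; apply: noi; exists i.
rewrite -(dnorm_eq0 dot); apply/eqP; have [t {2}->] := monomial_span u.
rewrite linear_sumr big1 // => y _.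
by rewrite linearZr_LR /= uo mulr0.
Qed.

End Monomials.
End Bosons.

(** * Operators bilinear in creation and annihilation operators *)

Section Bilinears.
Variables (C : numClosedFieldType) (V : lmodType C).
Variables (n : nat) (J : finType).
Implicit Types cr an : 'I_n * J -> {linear V -> V}.
Implicit Types A B P Q : 'M[C]_n.

(** The Jordan-Schwinger map: the second quantisation of the matrix [A] acting on the first index
    and trivially on [J]. *)
Definition bilinear_op cr an A (v : V) : V :=
  \sum_(j : J) \sum_k \sum_l A k l *: cr (k, j) (an (l, j) v).

Lemma bilinear_op_is_linear cr an A : linear (bilinear_op cr an A).
Proof.
move=> a u v; rewrite /bilinear_op scaler_sumr -big_split; apply: eq_bigr => j _ /=.
rewrite scaler_sumr -big_split; apply: eq_bigr => k _ /=.
rewrite scaler_sumr -big_split; apply: eq_bigr => l _ /=.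
by rewrite !linearP.
Qed.

HB.instance Definition _ cr an A :=
  GRing.isLinear.Build C V V _ (bilinear_op cr an A) (bilinear_op_is_linear cr an A).

Lemma bilinear_opD cr an A B v :
  bilinear_op cr an (A + B) v = bilinear_op cr an A v + bilinear_op cr an B v.
Proof.
rewrite /bilinear_op -big_split; apply: eq_bigr => j _ /=.
rewrite -big_split; apply: eq_bigr => k _ /=.
rewrite -big_split; apply: eq_bigr => l _ /=.
by rewrite mxE scalerDl.
Qed.

Lemma bilinear_opZ cr an a A v :
  bilinear_op cr an (a *: A) v = a *: bilinear_op cr an A v.
Proof.
rewrite /bilinear_op scaler_sumr; apply: eq_bigr => j _ /=.
rewrite scaler_sumr; apply: eq_bigr => k _ /=.
rewrite scaler_sumr; apply: eq_bigr => l _ /=.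
by rewrite mxE scalerA.
Qed.

Lemma bilinear_opB cr an A B v :
  bilinear_op cr an (A - B) v = bilinear_op cr an A v - bilinear_op cr an B v.
Proof. by rewrite bilinear_opD -(scaleN1r B) bilinear_opZ scaleN1r. Qed.

Lemma bilinear_op_diag cr an (d : 'rV[C]_n) v :
  bilinear_op cr an (diag_mx d) v =
  \sum_(g : 'I_n * J) d 0 g.1 *: cr g (an g v).
Proof.
rewrite [RHS](eq_bigr (fun g => d 0 g.1 *: cr (g.1, g.2) (an (g.1, g.2) v)));
  last by case.
rewrite -(pair_bigA _ (fun k j => d 0 k *: cr (k, j) (an (k, j) v))) exchange_big /=.
apply: eq_bigr => j _; apply: eq_bigr => k _.
rewrite (bigD1 k) //= mxE eqxx mulr1n big1 ?addr0 // => l /negPf kl.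
by rewrite mxE eq_sym kl mulr0n scale0r.
Qed.

Section Commutators.
Variables (cr an : 'I_n * J -> {linear V -> V}).
Hypothesis ccr : boson_ccr cr an.

Lemma bilinear_op_cr A m i v : bilinear_op cr an A (cr (m, i) v) =
  cr (m, i) (bilinear_op cr an A v) + \sum_k A k m *: cr (k, i) v.
Proof.
have [crC _ anC] := ccr.
rewrite /bilinear_op linear_sum.
under eq_bigr => j _ do under eq_bigr => k _ do under eq_bigr => l _ do
  rewrite anC linearD linearZ /= crC scalerDr scalerA.
under eq_bigr => j _ do under eq_bigr => k _ do rewrite big_split.
under eq_bigr => j _ do rewrite big_split.
rewrite big_split /=; congr (_ + _).
  apply: eq_bigr => j _; rewrite linear_sum; apply: eq_bigr => k _.
  by rewrite linear_sum; apply: eq_bigr => l _; rewrite linearZ.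
rewrite (bigD1 i) //= [X in _ + X]big1 ?addr0 => [|j /negPf ji].
  apply: eq_bigr => k _; rewrite (bigD1 m) //= eqxx mulr1 big1 ?addr0 // => l lm.
  by rewrite xpair_eqE (negPf lm) mulr0 scale0r.
by rewrite big1 // => k _; rewrite big1 // => l _; rewrite xpair_eqE ji andbF mulr0 scale0r.
Qed.

Lemma bilinear_op_an A m i v : bilinear_op cr an A (an (m, i) v) =
  an (m, i) (bilinear_op cr an A v) - \sum_l A m l *: an (l, i) v.
Proof.
have [_ anan anC] := ccr; apply/eqP; rewrite -subr_eq opprK addrC eq_sym; apply/eqP.
rewrite /bilinear_op linear_sum.
under eq_bigr => j _ do rewrite linear_sum.
under eq_bigr => j _ do under eq_bigr => k _ do rewrite linear_sum.
under eq_bigr => j _ do under eq_bigr => k _ do under eq_bigr => l _ do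
  rewrite linearZ /= anC anan scalerDr scalerA addrC.
under eq_bigr => j _ do under eq_bigr => k _ do rewrite big_split.
under eq_bigr => j _ do rewrite big_split.
rewrite big_split /=; congr (_ + _).
rewrite (bigD1 i) //= [X in _ + X]big1 ?addr0 => [|j /negPf ji].
  rewrite (bigD1 m) //= [X in _ + X]big1 ?addr0 => [|k /negPf km].
    by apply: eq_bigr => l _; rewrite eqxx mulr1.
  by rewrite big1 // => l _; rewrite xpair_eqE eq_sym km mulr0 scale0r.
rewrite big1 // => k _; rewrite big1 // => l _.
by rewrite xpair_eqE [i == j]eq_sym ji andbF mulr0 scale0r.
Qed.

(** The operator of [A] acts as a derivation on products of a creation and an annihilation operator;
    the creation factor yields [A *m B] and the annihilation factor [- (B *m A)]. *)
Lemma bilinear_op_comm A B v :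
  bilinear_op cr an A (bilinear_op cr an B v) =
  bilinear_op cr an B (bilinear_op cr an A v) +
  bilinear_op cr an (A *m B - B *m A) v.
Proof.
rewrite bilinear_opB.
rewrite {2}/bilinear_op linear_sum.
under eq_bigr => j _ do rewrite linear_sum.
under eq_bigr => j _ do under eq_bigr => k _ do rewrite linear_sum.
under eq_bigr => j _ do under eq_bigr => k _ do under eq_bigr => l _ do
  rewrite linearZ /= bilinear_op_cr bilinear_op_an linearB scalerDr scalerBr -addrA.
under eq_bigr => j _ do under eq_bigr => k _ do rewrite big_split.
under eq_bigr => j _ do rewrite big_split.
rewrite big_split /=; congr (_ + _).
under eq_bigr => j _ do under eq_bigr => k _ do rewrite big_split.
under eq_bigr => j _ do rewrite big_split.
rewrite big_split /= addrC; congr (_ + _).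
  apply: eq_bigr => j _; under eq_bigr => k _ do under eq_bigr => l _ do
    rewrite scaler_sumr.
  rewrite exchange_big /=.
  under eq_bigr => l _ do rewrite exchange_big /=.
  rewrite exchange_big; apply: eq_bigr => g _; apply: eq_bigr => l _.
  rewrite mxE scaler_suml; apply: eq_bigr => k _.
  by rewrite scalerA mulrC.
rewrite -sumrN; apply: eq_bigr => j _; rewrite -sumrN; apply: eq_bigr => k _.
rewrite -sumrN.
under eq_bigr => l _ do rewrite linear_sum scaler_sumr -sumrN.
rewrite exchange_big; apply: eq_bigr => h _ /=.
rewrite mxE scaler_suml -sumrN; apply: eq_bigr => l _.
have crZ a u : cr (k, j) (a *: u) = a *: cr (k, j) u by exact: linearZ.
by rewrite crZ scalerA.
Qed.

End Commutators.

Lemma bilinear_op_adj (dot : {dot V for Num.conj}) cr an A u v :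
  (forall g u v, dot (cr g u) v = dot u (an g v)) ->
  dot (bilinear_op cr an A u) v = dot u (bilinear_op cr an (\matrix_(k, l) (A l k)^*) v).
Proof.
move=> crA; rewrite /bilinear_op linear_sumlz linear_sumr; apply: eq_bigr => j _.
rewrite linear_sumlz linear_sumr.
under eq_bigr => k _ do rewrite linear_sumlz.
under [RHS]eq_bigr => k _ do rewrite linear_sumr.
rewrite exchange_big; apply: eq_bigr => k _; apply: eq_bigr => l _ /=.
rewrite linearZl_LR linearZr_LR /= mxE conjCK crA.
by rewrite (dot_adj (crA _)).
Qed.

Section ChangeOfModes.
Variables (cr an : 'I_n * J -> {linear V -> V}) (P Q : 'M[C]_n).

Definition mix (M : 'M[C]_n) (f : 'I_n * J -> {linear V -> V}) (g : 'I_n * J) (v : V) : V :=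
  \sum_l M g.1 l *: f (l, g.2) v.

Lemma mix_is_linear M f g : linear (mix M f g).
Proof.
move=> a u v; rewrite /mix scaler_sumr -big_split; apply: eq_bigr => l _ /=.
by rewrite !linearP.
Qed.

HB.instance Definition _ M f g :=
  GRing.isLinear.Build C V V _ (mix M f g) (mix_is_linear M f g).

Definition mixed_mode M f : 'I_n * J -> {linear V -> V} := fun g => mix M f g.

(** The commutator of the new annihilation mode k with the new creation mode l is the (k, l) entry
    of [Q *m P^T]. *)
Lemma mixed_mode_ccr : boson_ccr cr an -> Q *m P^T = 1%:M ->
  boson_ccr (mixed_mode P cr) (mixed_mode Q an).
Proof.
move=> [crC anan anC] QP; split=> g h v; rewrite /mixed_mode /= /mix.
- under eq_bigr do rewrite linear_sum scaler_sumr.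
  under [RHS]eq_bigr do rewrite linear_sum scaler_sumr.
  rewrite exchange_big; apply: eq_bigr => k _; apply: eq_bigr => l _.
  by rewrite !linearZ /= crC !scalerA mulrC.
- under eq_bigr do rewrite linear_sum scaler_sumr.
  under [RHS]eq_bigr do rewrite linear_sum scaler_sumr.
  rewrite exchange_big; apply: eq_bigr => k _; apply: eq_bigr => l _.
  by rewrite !linearZ /= anan !scalerA mulrC.
under eq_bigr do rewrite linear_sum scaler_sumr.
under [in RHS]eq_bigr do rewrite linear_sum scaler_sumr.
rewrite [X in _ = X + _]exchange_big.
under eq_bigr => k _ do under eq_bigr => l _ do
  rewrite linearZ /= anC !scalerDr !scalerA.
under eq_bigr => k _ do rewrite big_split.
rewrite big_split /=; congr (_ + _).
  apply: eq_bigr => k _; apply: eq_bigr => l _.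
  by rewrite linearZ /= scalerA mulrC.
have := congr1 (fun M : 'M_n => M g.1 h.1) QP; rewrite !mxE => QPgh.
rewrite (_ : (g == h) = (g.1 == h.1) && (g.2 == h.2)); last by case: g {QPgh} h.
case: (g.2 =P h.2) => gh2; last first.
  rewrite andbF scale0r big1 // => k _; rewrite big1 // => l _.
  by rewrite xpair_eqE (introF eqP gh2) andbF !mulr0 scale0r.
rewrite andbT -QPgh scaler_suml; apply: eq_bigr => k _.
rewrite mxE (bigD1 k) //= gh2 eqxx mulr1 big1 ?addr0 // => l /negPf lk.
by rewrite xpair_eqE eq_sym lk !mulr0 scale0r.
Qed.

(** For diagonal [B] the left side is a combination of number operators, so factoring a matrix as
    [P^T *m B *m Q] diagonalises its operator on monomials in the mixed modes. *)
Lemma mixed_mode_bilinear B v :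
  bilinear_op (mixed_mode P cr) (mixed_mode Q an) B v =
  bilinear_op cr an (P^T *m B *m Q) v.
Proof.
apply: eq_bigr => j _; rewrite /mixed_mode /= /mix /=.
under eq_bigr => k _ do under eq_bigr => l _ do rewrite scaler_sumr.
under eq_bigr => k _ do rewrite exchange_big.
rewrite exchange_big; apply: eq_bigr => p _ /=.
under eq_bigr => k _ do under eq_bigr => l _ do rewrite linear_sum !scaler_sumr.
under eq_bigr => k _ do rewrite exchange_big.
rewrite exchange_big; apply: eq_bigr => q _ /=.
rewrite mxE scaler_suml exchange_big; apply: eq_bigr => l _ /=.
rewrite mxE mulr_suml scaler_suml; apply: eq_bigr => k _ /=.
have crZ a u : cr (p, j) (a *: u) = a *: cr (p, j) u by exact: linearZ.
by rewrite crZ !scalerA mxE; congr (_ *: _); ring.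
Qed.

Lemma mixed_mode_adj (dot : {dot V for Num.conj}) (s : 'I_n -> C) g u v :
  (forall g u v, dot (cr g u) v = dot u (an g v)) ->
  (forall k l, s k * (Q k l)^* = P k l) ->
  dot (mixed_mode P cr g u) v = s g.1 * dot u (mixed_mode Q an g v).
Proof.
move=> crA sQ; rewrite /mixed_mode /= /mix linear_sumlz linear_sumr mulr_sumr.
apply: eq_bigr => l _; rewrite linearZl_LR linearZr_LR /= crA -sQ.
by rewrite mulrA.
Qed.

End ChangeOfModes.
End Bilinears.

(** * Rotations *)

Section RotationMatrices.
Variable C : numClosedFieldType.

Definition mx3 (s : seq (seq C)) : 'M[C]_3 := \matrix_(k, l) (nth [::] s k)`_l.

(** The rows give b_1 + i b_2, b_1 - i b_2 and b_3, left unnormalised to keep the square root of 2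
    out; the compensating halves sit in [circ_an]. *)
Definition circ_cr := mx3 [:: [:: 1; 'i; 0]; [:: 1; - 'i; 0]; [:: 0; 0; 1]].
Definition circ_an := mx3 [:: [:: 2^-1; - 'i / 2; 0]; [:: 2^-1; 'i / 2; 0]; [:: 0; 0; 1]].
(* Up to these factors the circular modes of the rows of [circ_cr] and
   [circ_an] are adjoint to each other. *)
Definition circ_norm (k : 'I_3) : C := [:: 2; 2; 1]`_k.
Definition circ_weight : 'rV[C]_3 := \row_k [:: 1; -1; 0]`_k.

(** [A0], [Ap], [Am] are J_3, J_1 + i J_2, J_1 - i J_2 in the vector representation, in units of
    hbar. *)
Definition A0 := mx3 [:: [:: 0; - 'i; 0]; [:: 'i; 0; 0]; [:: 0; 0; 0]].
Definition Ap := mx3 [:: [:: 0; 0; -1]; [:: 0; 0; - 'i]; [:: 1; 'i; 0]].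
Definition Am := mx3 [:: [:: 0; 0; 1]; [:: 0; 0; - 'i]; [:: -1; 'i; 0]].

Definition ang_mx (j : 'I_3) : 'M[C]_3 := \matrix_(k, l) (- 'i * (levi_civita j k l)%:~R).

Let half_ii : 'i / 2 * 'i = - 2^-1 :> C.
Proof. by rewrite mulrAC mulCii mulN1r. Qed.

Let conjNi : (- 'i)^* = 'i :> C.
Proof. by rewrite rmorphN /= conjCi opprK. Qed.

Ltac mx3_tac :=
  apply/matrixP => -[[|[|[|//]]] ?] [[|[|[|//]]] ?];
  rewrite !(mxE, big_ord_recl, big_ord0) /= /bump /=;
  rewrite ?(mul0r, mulr0, mul1r, mulr1, add0r, addr0, mulNr, mulrN,
    mulCii, half_ii, conjCi, conjNi, opprK, oppr0,
    conjC0, conjC1,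
    mulr0n, mulr1n);
  try by [field | ring].

Lemma circ_anK : circ_an *m circ_cr^T = 1%:M.
Proof. mx3_tac. Qed.

Lemma A0_diag : circ_cr^T *m diag_mx circ_weight *m circ_an = A0.
Proof. mx3_tac. Qed.

Lemma comm_A0p : A0 *m Ap - Ap *m A0 = Ap.
Proof. mx3_tac. Qed.

Lemma comm_A0m : A0 *m Am - Am *m A0 = - Am.
Proof. mx3_tac. Qed.

Lemma comm_Apm : Ap *m Am - Am *m Ap = 2 *: A0.
Proof. mx3_tac. Qed.

Lemma A0_adj : \matrix_(k, l) (A0 l k)^* = A0.
Proof. mx3_tac. Qed.

Lemma Ap_adj : \matrix_(k, l) (Ap l k)^* = Am.
Proof. mx3_tac. Qed.

Lemma circ_adj k l : circ_norm k * (circ_an k l)^* = circ_cr k l.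
Proof.
case: k l => -[|[|[|//]]] ? [[|[|[|//]]] ?]; rewrite !mxE /circ_norm /=;
  rewrite ?(rmorphM, rmorphN) /= ?fmorphV ?(conjC0, conjC1, conjC_nat, conjCi, opprK) /=;
  by field.
Qed.

Lemma ang_mx0 : ang_mx 0 = 2^-1 *: Ap + 2^-1 *: Am.
Proof. mx3_tac. Qed.

Lemma ang_mx1 : ang_mx 1 = (- 'i / 2) *: Ap + ('i / 2) *: Am.
Proof. mx3_tac. Qed.

Lemma ang_mx2 : ang_mx 2 = A0.
Proof. mx3_tac. Qed.

Lemma Ap_ang : Ap = ang_mx 0 + 'i *: ang_mx 1.
Proof. mx3_tac. Qed.

Lemma Am_ang : Am = ang_mx 0 + (- 'i) *: ang_mx 1.
Proof. mx3_tac. Qed.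

End RotationMatrices.

(** * Counting monomials *)

Section Counting.
Local Open Scope nat_scope.

Definition triangular (s : nat) : nat := \sum_(Q < s.+1) Q.+1.

Lemma triangularS s : triangular s.+1 = triangular s + s.+2.
Proof. by rewrite /triangular big_ord_recr. Qed.

Lemma double_triangular s : 2 * triangular s = s.+1 * s.+2.
Proof.
elim: s => [|s IH]; first by rewrite /triangular big_ord_recr big_ord0.
by rewrite triangularS mulnDr IH; lia.
Qed.

(** The number of admissible Q, which run from 0 to (N-m)/2. Without the test, truncated subtraction
    would give 1 instead of 0 for m > N. *)
Definition weight_bound (N m : nat) : nat := if m <= N then ((N - m)./2).+1 else 0.

Definition weight_dim (N m : nat) : nat :=
  \sum_(Q < weight_bound N m) (Q + m).+1 * Q.+1 * (N - m - 2 * Q).+1.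

(* Multiplicity of spin [j] among the homogeneous polynomials of degree [N]. *)
Definition mult (N j : nat) : nat :=
  if j <= N then
    if odd (N - j) then j * triangular (N - j)./2 else j.+1 * triangular (N - j)./2
  else 0.

(** The quadratic part is 3 times the sum of Q(Q+1), that is s(s+1)(s+2), or 2s times the triangular
    number. *)
Lemma sum_triangular s m :
  \sum_(Q < s.+1) Q.+1 * (3 * Q + m) = m * triangular s + 2 * s * triangular s.
Proof.
elim: s => [|s IH].
  by rewrite big_ord_recr big_ord0 /triangular big_ord_recr big_ord0 /=; lia.
rewrite big_ord_recr /= IH triangularS; have := double_triangular s; nia.
Qed.

(** With r = N - j, the terms of index Q for j and j+1 differ by (Q+1)(3Q + j - 2s) if r = 2s+1 and
    by (Q+1)(3Q + j + 1 - 2s) if r = 2s; [sum_triangular] cancels the part in 2s. *)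
Lemma weight_dim_mult N j : mult N j + weight_dim N j.+1 = weight_dim N j.
Proof.
rewrite /mult /weight_dim /weight_bound; have [jN|Nj] := leqP j N; last first.
  by rewrite (leqNgt j.+1) (ltn_trans Nj) // !big_ord0.
have [r ->] : exists r, N = (j + r)%N by exists (N - j); lia.
have -> : (j + r - j = r)%N by lia.
have -> : (j + r - j.+1 = r.-1)%N by lia.
have [or|er] := boolP (odd r).
  have [s ->] : exists s, r = s.*2.+1 by exists r./2; rewrite -[LHS]odd_double_half or.
  have -> : (j < j + s.*2.+1) by lia.
  rewrite /= uphalf_double doubleK.
  (* The negative term 2s(Q+1) is moved to the left so that no natural subtraction of terms
     occurs. *)
  have : \sum_(Q < s.+1) ((Q + j).+1 * Q.+1 * (s.*2.+1 - 2 * Q).+1 + 2 * s * Q.+1) =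
    \sum_(Q < s.+1) (Q.+1 * (3 * Q + j) + (Q + j.+1).+1 * Q.+1 * (s.*2 - 2 * Q).+1).
    apply: eq_bigr => Q _; have Qs := ltn_ord Q.
    have [d Ed] : exists d, s = (Q + d)%N by exists (s - Q); lia.
    have -> : s.*2.+1 - 2 * Q = 2 * d + 1 by lia.
    have -> : s.*2 - 2 * Q = 2 * d by lia.
    by move: (nat_of_ord Q) Ed => q ->; lia.
  rewrite [LHS]big_split [RHS]big_split /= sum_triangular -big_distrr /= -/(triangular s).
  lia.
have [s ->] : exists s, r = s.*2 by exists r./2; rewrite -[LHS]odd_double_half (negPf er).
have -> : (if j < j + s.*2 then (s.*2.-1)./2.+1 else 0) = s by case: ifP; lia.
rewrite doubleK.
(* The range for j+1 is one shorter; the added term Q = s has the factor 2s - 2s = 0. *)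
have -> : \sum_(Q < s) (Q + j.+1).+1 * Q.+1 * (s.*2.-1 - 2 * Q).+1 =
   \sum_(Q < s.+1) (Q + j.+1).+1 * Q.+1 * (s.*2 - 2 * Q).
  rewrite [RHS]big_ord_recr /= (_ : s.*2 - 2 * s = 0) ?muln0 ?addn0; last by lia.
  apply: eq_bigr => Q _; have Qs := ltn_ord Q; congr (_ * _); lia.
have : \sum_(Q < s.+1) ((Q + j).+1 * Q.+1 * (s.*2 - 2 * Q).+1 + 2 * s * Q.+1) =
  \sum_(Q < s.+1) (Q.+1 * (3 * Q + j.+1) + (Q + j.+1).+1 * Q.+1 * (s.*2 - 2 * Q)).
  apply: eq_bigr => Q _; have Qs := ltn_ord Q.
  have [d Ed] : exists d, s = (Q + d)%N by exists (s - Q); lia.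
  have -> : s.*2 - 2 * Q = 2 * d by lia.
  by move: (nat_of_ord Q) Ed => q ->; lia.
rewrite [LHS]big_split [RHS]big_split /= sum_triangular -big_distrr /= -/(triangular s).
lia.
Qed.

Implicit Type x : {ffun 'I_3 * 'I_2 -> nat}.

Definition degree x : nat := \sum_g x g.
Definition row_degree x (k : 'I_3) : nat := \sum_i x (k, i).

(* [Q] is the number of quanta of weight -1, hence [Q + m] that of weight 1;
   each of the three row degrees is then split between the two particles. *)
Definition weight_index (N m : nat) : finType :=
  {Q : 'I_(weight_bound N m) & ('I_(Q + m).+1 * 'I_Q.+1 * 'I_(N - m - 2 * Q).+1)%type}.

Lemma card_weight_index N m : #|weight_index N m| = weight_dim N m.
Proof.
rewrite card_tagged sumnE big_map big_enum /=; apply: eq_bigr => Q _.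
by rewrite !card_prod !card_ord.
Qed.

Definition mk_exponent (t : seq nat) : {ffun 'I_3 * 'I_2 -> nat} :=
  [ffun g : 'I_3 * 'I_2 => nth 0 t (2 * g.1 + g.2)].

Definition weight_exponent N m (i : weight_index N m) : {ffun 'I_3 * 'I_2 -> nat} :=
  let: existT Q (p, q, r) := i in
  mk_exponent [:: val p; Q + m - p; val q; Q - q; val r; N - m - 2 * Q - r].

Lemma weight_exponent_inj N m : injective (@weight_exponent N m).
Proof.
move=> [Q [[p q] r]] [Q' [[p' q'] r']] /ffunP E.
have Ek k : nth 0 [:: val p; Q + m - p; val q; Q - q; val r; N - m - 2 * Q - r] k =
  nth 0 [:: val p'; Q' + m - p'; val q'; Q' - q'; val r'; N - m - 2 * Q' - r'] k.
  have [k6|k6] := ltnP k 6; last by rewrite !nth_default.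
  have := E (inord (k./2), inord (odd k)); rewrite !ffunE /= !inordK.
  - by rewrite (_ : 2 * k./2 + odd k = k) // mul2n addnC odd_double_half.
  - by case: (odd k).
  - by rewrite ltn_half_double.
(* Entries 2 and 3 of the exponent are q and Q - q, so their sum recovers Q. *)
have QQ : Q = Q'.
  apply: val_inj; move: (Ek 2) (Ek 3) (ltn_ord q) (ltn_ord q') => /=; lia.
case: Q' / QQ p' q' r' Ek {E} => p' q' r' Ek.
have -> : p' = p by apply: val_inj; exact: esym (Ek 0).
have -> : q' = q by apply: val_inj; exact: esym (Ek 2).
by have -> : r' = r by apply: val_inj; exact: esym (Ek 4).
Qed.

Lemma row_degreeE x k : row_degree x k = x (k, ord0) + x (k, ord_max).
Proof.
by rewrite /row_degree big_ord_recr big_ord1 /=; congr (x (_, _) + x _); apply: val_inj.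
Qed.

Lemma degreeE x : degree x = row_degree x 0%R + row_degree x 1%R + row_degree x 2%:R%R.
Proof.
rewrite /degree (eq_bigr (fun g => x (g.1, g.2))); last by case.
rewrite -(pair_bigA _ (fun k i => x (k, i))) /= (eq_bigr (row_degree x)) //.
rewrite !big_ord_recr big_ord0 /= add0n.
by congr (row_degree x _ + row_degree x _ + row_degree x _); apply: val_inj.
Qed.

Lemma weight_exponent_degree N m (i : weight_index N m) :
  degree (weight_exponent i) = N /\
  row_degree (weight_exponent i) 0%R = m + row_degree (weight_exponent i) 1%R.
Proof.
rewrite degreeE !row_degreeE; case: i => Q [[p q] r]; rewrite !ffunE /=.
have := ltn_ord Q; rewrite {2}/weight_bound; case: ifP => // mN QN.
have := ltn_ord p; have := ltn_ord q; have := ltn_ord r; lia.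
Qed.

Lemma weight_exponent_surj N m x : degree x = N ->
  row_degree x 0%R = m + row_degree x 1%R ->
  exists i : weight_index N m, weight_exponent i = x.
Proof.
rewrite degreeE !row_degreeE => degx rowx.
pose Q := x (1%R, ord0) + x (1%R, ord_max).
have [ltQ ltp ltr Ep Er] : [/\ Q < weight_bound N m, x (0%R, ord0) < (Q + m).+1,
    x (2%:R%R, ord0) < (N - m - 2 * Q).+1, x (0%R, ord_max) = Q + m - x (0%R, ord0)
    & x (2%:R%R, ord_max) = N - m - 2 * Q - x (2%:R%R, ord0)].
  rewrite /Q /weight_bound; move: degx rowx; move: (x (0%R, _)) (x (0%R, _))
    (x (1%R, _)) (x (1%R, _)) (x (2%:R%R, _)) (x (2%:R%R, _)) => p p' q q' r r' Nx mx.
  by split; try case: ifP; lia.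
have ltq : x (1%R, ord0) < Q.+1 by rewrite ltnS leq_addr.
have Eq : x (1%R, ord_max) = Q - x (1%R, ord0) by rewrite addKn.
exists (existT (fun Q : 'I_(weight_bound N m) =>
  ('I_(Q + m).+1 * 'I_Q.+1 * 'I_(N - m - 2 * Q).+1)%type) (Ordinal ltQ)
  (Ordinal (ltp : _ < (Ordinal ltQ + m).+1), Ordinal (ltq : _ < (Ordinal ltQ).+1),
   Ordinal (ltr : _ < (N - m - 2 * Ordinal ltQ).+1))).
apply/ffunP => -[k i]; rewrite ffunE /=.
have -> : (k, i) = (inord k, inord i) :> 'I_3 * 'I_2 by rewrite !inord_val.
have E0 : inord 0 = 0%R :> 'I_3 by apply: val_inj; rewrite /= inordK.
have E1 : inord 1 = 1%R :> 'I_3 by apply: val_inj; rewrite /= inordK.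
have E2 : inord 2 = 2%:R%R :> 'I_3 by apply: val_inj; rewrite /= inordK.
have F0 : inord 0 = ord0 :> 'I_2 by apply: val_inj; rewrite /= inordK.
have F1 : inord 1 = ord_max :> 'I_2 by apply: val_inj; rewrite /= inordK.
by case: k i => -[|[|[|//]]] /= _ [[|[|//]]] /= _; rewrite ?(E0, E1, E2, F0, F1) /=.
Qed.

End Counting.

(** * The generating series as a quotient *)

Section GeneratingSeries.

(** The shift by 3 is the zero-point energy of the six modes. *)
Definition series_coef (n : nat) : {poly int} :=
  if (3 <= n)%N then \poly_(j < (n - 3).+1) (mult (n - 3) j)%:Z else 0.

Variable n : nat.
Local Notation PP := {poly {poly int}}.

(** Congruence modulo z^(n+1): polynomials stand in for power series, since only the coefficient of
    z^n is compared at the end. *)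
Definition eqtrunc (p q : PP) : Prop := forall i, (i <= n)%N -> p`_i = q`_i.

Lemma eqtruncM p p' q q' : eqtrunc p p' -> eqtrunc q q' -> eqtrunc (p * q) (p' * q').
Proof.
move=> pp qq i ni; rewrite !coefM; apply: eq_bigr => k _.
have := ltn_ord k; rewrite ltnS => ki.
by rewrite pp ?qq // ?(leq_trans _ ni) // leq_subr.
Qed.

Definition even_triangular (k : nat) : nat := if odd k then 0%N else triangular k./2.

(** [Jser] and [Tser] are the truncations of 1/(1 - Jz)^2 and 1/(1 - z^2)^3. *)
Definition Jser : PP := \poly_(i < n.+1) (i.+1%:R *: 'X^i).
Definition Tser : PP := \poly_(i < n.+1) (even_triangular i)%:R.

Lemma Jser_inv : eqtrunc (Jser * (1 - Jvar * zvar) ^+ 2) 1.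
Proof.
move=> k kn.
have -> : Jser * (1 - Jvar * zvar) ^+ 2 =
    Jser - 2 * (Jvar * (Jser * 'X)) + Jvar * (Jvar * (Jser * 'X^2)) by ring.
have Jk i : (i <= k)%N -> Jser`_i = i.+1%:R * 'X^i.
  by move=> ik; rewrite coef_poly ltnS (leq_trans ik kn) scaler_nat mulr_natl.
rewrite coefD coefB mulr_natl coefMn !coefCM coefMX coefMXn coef1.
rewrite !Jk ?leq_subr ?leq_pred //.
case: k {kn Jk} => [|[|k]] /=; [ring | ring |].
rewrite subn2 /= !exprS; ring.
Qed.

Lemma Tser_inv : eqtrunc (Tser * (1 - zvar ^+ 2) ^+ 3) 1.
Proof.
move=> k kn.
have -> : Tser * (1 - zvar ^+ 2) ^+ 3 =
   Tser - 3 * (Tser * 'X^2) + 3 * (Tser * 'X^4) - Tser * 'X^6 by ring.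
have Tk i : (i <= k)%N -> Tser`_i = (even_triangular i)%:R.
  by move=> ik; rewrite coef_poly ltnS (leq_trans ik kn).
rewrite coefB coefD coefB !mulr_natl !coefMn !coefMXn coef1.
rewrite !Tk ?leq_subr // {kn Tk} /even_triangular.
have t0 : triangular 0 = 1%N by rewrite /triangular big_ord1.
case: k => [|[|[|[|[|[|k]]]]]] /=; rewrite ?triangularS ?t0; do ?ring.
rewrite subSS !subSS !subn0 /= !negbK.
case: (odd k); rewrite /= ?negbK ?triangularS; ring.
Qed.

Lemma JTser_coef k j : (k <= n)%N ->
  (Jser * Tser)`_k`_j = if (j <= k)%N then (j.+1 * even_triangular (k - j))%:Z else 0.
Proof.
move=> kn; rewrite coefM coef_sum.
have [jk|kj] := leqP j k; last first.
  rewrite big1 // => i _; have ik := ltn_ord i.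
  rewrite !coef_poly; case: ifP => _; last by rewrite mul0r coef0.
  case: ifP => _; last by rewrite mulr0 coef0.
  rewrite mulr_natr coefMn coefZ coefXn gtn_eqF ?mulr0 ?mul0rn //; lia.
have jk' : (j < k.+1)%N by [].
rewrite (bigD1 (Ordinal jk')) //= big1 ?addr0 => [|i ij].
  have jn : (j < n.+1)%N by lia.
  have kjn : (k - j < n.+1)%N by lia.
  rewrite !coef_poly jn kjn mulr_natr coefMn coefZ coefXn eqxx mulr1.
  by rewrite -(mulr_natr j.+1%:R) -natrM natz.
rewrite !coef_poly; case: ifP => _; last by rewrite mul0r coef0.
case: ifP => _; last by rewrite mulr0 coef0.
rewrite mulr_natr coefMn coefZ coefXn; case: eqP => [ji|]; last by rewrite mulr0 mul0rn.
by move: ij; rewrite -val_eqE /= ji eqxx.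
Qed.

(** In the numerator, the summand 1 produces the coefficients with N - j even and J z^2 those with N
    - j odd; [even_triangular] vanishes at odd arguments, so the two never overlap. *)
Lemma series_coef_trunc : eqtrunc (\poly_(i < n.+1) series_coef i)
  ((1 + Jvar * zvar ^+ 2) * zvar ^+ 3 * (Jser * Tser)).
Proof.
move=> i ni.
have -> : (1 + Jvar * zvar ^+ 2) * zvar ^+ 3 * (Jser * Tser) =
  (Jser * Tser) * 'X^3 + Jvar * ((Jser * Tser) * 'X^5) by ring.
rewrite coefD coefCM !coefMXn coef_poly ltnS ni /series_coef.
have [i3|i3] := ltnP i 3; first by rewrite (ltn_trans i3) // mulr0 addr0.
apply/polyP => j; rewrite coefD coef_poly JTser_coef; last by lia.
rewrite [X in _ = _ + X](_ : _ = if (0 < j <= i - 4)%N && (5 <= i)%N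
    then (j * even_triangular (i - 3 - j).-1)%:Z else 0); last first.
  rewrite coefXM; case: j => [|j] //=; case: ltnP => i5; first by rewrite andbF coef0.
  rewrite JTser_coef; last by lia.
  rewrite andbT (_ : (j < i - 4)%N = (j <= i - 5)%N); last by lia.
  by rewrite (_ : (i - 3 - j.+1).-1 = (i - 5 - j)%N) //; lia.
have [N Ei] : exists N, i = (N + 3)%N by exists (i - 3)%N; lia.
rewrite Ei addnK ltnS /mult /even_triangular; have [jN|Nj] := leqP j N; last first.
  by rewrite (_ : _ && _ = false) ?addr0 //; lia.
have [d ->] : exists d, N = (j + d)%N by exists (N - j)%N; lia.
rewrite addKn; have [od|ed] := boolP (odd d).
  rewrite muln0 add0r; have -> : odd d.-1 = false by lia.
  have -> : d.-1./2 = d./2 by lia.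
  case: j {Ei jN} => [|j]; first by rewrite mul0n.
  by rewrite ifT //; lia.
case: ifP => [jd|_]; last by rewrite addr0.
have -> : odd d.-1 by lia.
by rewrite muln0 addr0.
Qed.

Lemma series_quotient :
  \sum_(i < n.+1) series_coef i *
    (((1 - zvar ^+ 2) ^+ 3 * (1 - Jvar * zvar) ^+ 2) : PP)`_(n - i) =
  ((1 + Jvar * zvar ^+ 2) * zvar ^+ 3 : PP)`_n.
Proof.
set q : PP := (1 - zvar ^+ 2) ^+ 3 * _; set p : PP := _ * _.
transitivity ((\poly_(i < n.+1) series_coef i * q)`_n).
  by rewrite coefM; apply: eq_bigr => i _; rewrite coef_poly ltn_ord.
rewrite (eqtruncM series_coef_trunc (q' := q)) //.
have -> : p * (Jser * Tser) * q =
    p * (Jser * (1 - Jvar * zvar) ^+ 2) * (Tser * (1 - zvar ^+ 2) ^+ 3).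
  by rewrite /q; ring.
have pJ : eqtrunc (p * (Jser * (1 - Jvar * zvar) ^+ 2)) (p * 1).
  by apply: eqtruncM => //; exact: Jser_inv.
by rewrite (eqtruncM pJ Tser_inv) // !mulr1.
Qed.

End GeneratingSeries.

(** * Angular momentum multiplicities *)

Section TwoBodyOscillator.
Variables (C : numClosedFieldType) (V : lmodType C) (dot : {dot V for Num.conj}).
Variables (cr an : 'I_3 * 'I_2 -> {linear V -> V}) (vac : V).
Hypotheses (ccr : boson_ccr cr an) (vac_neq0 : vac != 0).
Hypothesis an_vac : forall g, an g vac = 0.
Hypothesis creation_adj : forall g u v, dot (cr g u) v = dot u (an g v).
Hypothesis vac_gen : forall U : {pred V}, submod_closed U -> vac \in U ->
  (forall g u, u \in U -> cr g u \in U /\ an g u \in U) -> forall v, v \in U.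

Local Notation bil := (bilinear_op cr an).
Local Notation L0 := (bil (A0 C)).
Local Notation Lp := (bil (Ap C)).
Local Notation Lm := (bil (Am C)).
Local Notation cr' := (mixed_mode (circ_cr C) cr).
Local Notation an' := (mixed_mode (circ_an C) an).
Local Notation mono := (monomial cr' vac).

(* The energy in units of [hbar * omega] is [e + 3]. *)
Definition level (e : C) : {pred V} := [pred v | bil 1%:M v == e *: v].

Lemma circ_crK : (circ_cr C)^T *m circ_an C = 1%:M.
Proof. exact/mulmx1C/circ_anK. Qed.

Lemma mixed_ccr : boson_ccr cr' an'.
Proof. exact: (mixed_mode_ccr ccr (circ_anK C)). Qed.

Lemma mixed_adj g u v : dot (cr' g u) v = circ_norm C g.1 * dot u (an' g v).
Proof.
by apply: (mixed_mode_adj (s := circ_norm C)); [exact: creation_adj | exact: circ_adj].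
Qed.

Lemma circ_norm_gt0 (g : 'I_3 * 'I_2) : 0 < circ_norm C g.1.
Proof. by case: g => -[[|[|[|//]]] ?] ? /=; rewrite /circ_norm /= ?ltr0n ?ltr01. Qed.

Lemma mixed_an_vac g : an' g vac = 0.
Proof.
rewrite /mixed_mode /= /mix big1 // => l _.
by rewrite an_vac scaler0.
Qed.

Lemma mixed_modeK (M N : 'M[C]_3) (f : 'I_3 * 'I_2 -> {linear V -> V}) k i v :
  N^T *m M = 1%:M -> \sum_l N l k *: mixed_mode M f (l, i) v = f (k, i) v.
Proof.
move=> NM; rewrite /mixed_mode /= /mix /=.
under eq_bigr do rewrite scaler_sumr.
rewrite exchange_big /= (bigD1 k) //= [X in _ + X]big1 ?addr0 => [|l /negPf lk].
  have := congr1 (fun A : 'M_3 => A k k) NM; rewrite !mxE eqxx mulr1n => NM1.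
  rewrite -[RHS]scale1r -NM1 scaler_suml; by apply: eq_bigr => l _; rewrite scalerA mxE.
have := congr1 (fun A : 'M_3 => A k l) NM; rewrite !mxE eq_sym lk mulr0n => NM0.
rewrite -[RHS](scale0r (f (l, i) v)) -NM0 scaler_suml.
by apply: eq_bigr => p _; rewrite scalerA mxE.
Qed.

(** The original operators are combinations of the circular ones, so stability under the latter
    implies stability under the former. *)
Lemma mixed_vac_gen (U : {pred V}) : submod_closed U -> vac \in U ->
  (forall g u, u \in U -> cr' g u \in U /\ an' g u \in U) -> forall v, v \in U.
Proof.
move=> subU vacU stU; apply: vac_gen => // -[k i] u uU; split.
- rewrite -(@mixed_modeK (circ_cr C) (circ_an C)); last first.
    by rewrite -[LHS]trmxK trmx_mul trmxK circ_crK trmx1.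
  by apply: submod_sum => // l _; apply: submodZ => //; case: (stU (l, i) u uU).
- rewrite -(@mixed_modeK (circ_an C) (circ_cr C)) ?circ_crK //.
  by apply: submod_sum => // l _; apply: submodZ => //; case: (stU (l, i) u uU).
Qed.

Lemma rotation_stable (U : {pred V}) : submod_closed U ->
  (forall j u, u \in U -> bil (ang_mx C j) u \in U) <-> sl2_stable L0 Lp Lm U.
Proof.
move=> subU; split=> [stU u uU|stU j u /stU[/= L0U LpU LmU]].
  split=> /=; first by rewrite -ang_mx2; exact: stU.
    rewrite Ap_ang bilinear_opD bilinear_opZ; apply: (submodD subU); first exact: stU.
    by apply: (submodZ _ subU); exact: stU.
  rewrite Am_ang bilinear_opD bilinear_opZ; apply: (submodD subU); first exact: stU.
  by apply: (submodZ _ subU); exact: stU.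
case: j => -[|[|[|//]]] jlt.
- rewrite (_ : Ordinal jlt = 0) ?ang_mx0; last exact: val_inj.
  rewrite bilinear_opD !bilinear_opZ.
  by apply: (submodD subU); apply: (submodZ _ subU).
- rewrite (_ : Ordinal jlt = 1) ?ang_mx1; last exact: val_inj.
  rewrite bilinear_opD !bilinear_opZ.
  by apply: (submodD subU); apply: (submodZ _ subU).
- by rewrite (_ : Ordinal jlt = 2) ?ang_mx2 //; exact: val_inj.
Qed.

(** The identity is [circ_cr^T *m 1 *m circ_an], so the total number operator has the same form in
    the circular modes. *)
Lemma degree_monomial x : bil 1%:M (mono x) = (degree x)%:R *: mono x.
Proof.
rewrite -circ_crK -[(circ_cr C)^T]mulmx1 -mixed_mode_bilinear -diag_const_mx bilinear_op_diag.
rewrite /degree natr_sum scaler_suml; apply: eq_bigr => g _.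
by rewrite mxE scale1r (number_monomial mixed_ccr mixed_an_vac).
Qed.

Lemma weight_monomial x :
  L0 (mono x) = ((row_degree x 0)%:R - (row_degree x 1)%:R) *: mono x.
Proof.
rewrite -A0_diag -mixed_mode_bilinear bilinear_op_diag.
under eq_bigr => g _ do rewrite (number_monomial mixed_ccr mixed_an_vac) scalerA.
rewrite -scaler_suml; congr (_ *: _).
rewrite (eq_bigr (fun g => circ_weight C 0 g.1 * (x (g.1, g.2))%:R)); last by case.
rewrite -(pair_bigA _ (fun k i => circ_weight C 0 k * (x (k, i))%:R)) /=.
under eq_bigr do rewrite -mulr_sumr -natr_sum.
rewrite (eq_bigr (fun k => circ_weight C 0 k * (row_degree x k)%:R)) //.
rewrite !big_ord_recr big_ord0 /= !mxE /= add0r mul1r mul0r addr0 mulN1r.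
by congr ((row_degree x _)%:R - (row_degree x _)%:R); apply: val_inj.
Qed.

Lemma bil_adj (A B : 'M[C]_3) u v :
  \matrix_(k, l) (A l k)^* = B -> dot (bil A u) v = dot u (bil B v).
Proof. by move=> <-; exact: (bilinear_op_adj A u v creation_adj). Qed.

Lemma L0p v : L0 (Lp v) = Lp (L0 v) + Lp v.
Proof. by rewrite (bilinear_op_comm ccr) comm_A0p. Qed.

Lemma L0m v : L0 (Lm v) = Lm (L0 v) - Lm v.
Proof.
by rewrite (bilinear_op_comm ccr) comm_A0m -(scaleN1r (Am C)) bilinear_opZ scaleN1r.
Qed.

Lemma Lpm v : Lp (Lm v) = Lm (Lp v) + 2 *: L0 v.
Proof. by rewrite (bilinear_op_comm ccr) comm_Apm bilinear_opZ. Qed.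

Section Level.
Variable e : C.
Local Notation W := (level e).

Lemma level_submod : submod_closed W.
Proof.
split; first by rewrite inE linear0 scaler0.
move=> a u v; rewrite !inE => /eqP uW /eqP vW; apply/eqP.
by rewrite linearP /= uW vW scalerDr !scalerA mulrC.
Qed.

Lemma level_bilinear A u : u \in W -> bil A u \in W.
Proof.
rewrite !inE => /eqP uW; apply/eqP.
rewrite (bilinear_op_comm ccr) uW linearZ /=.
by rewrite mul1mx mulmx1 bilinear_opB subrr addr0.
Qed.

Lemma level_stable : sl2_stable L0 Lp Lm W.
Proof. by move=> u uW; split; exact: level_bilinear. Qed.

Lemma level_dot0 v y : v \in W -> e != (degree y)%:R -> dot v (mono y) = 0.
Proof.
move=> /eqP vW ey; apply: (dot_eigen0 _ vW (degree_monomial y)) => //.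
  move=> u w; rewrite (bilinear_op_adj _ _ _ creation_adj).
  congr (dot u (bil _ w)); apply/matrixP => k l; rewrite !mxE eq_sym.
  by rewrite conjC_nat.
exact: conjC_nat.
Qed.

Lemma level_expand (I : finType) (f : I -> {ffun 'I_3 * 'I_2 -> nat}) v :
  injective f ->
  (forall y, (forall i, f i <> y) -> dot v (mono y) = 0) ->
  spanned_by (fun i => mono (f i)) v.
Proof.
exact: (monomial_expand mixed_ccr circ_norm_gt0 mixed_adj vac_neq0 mixed_an_vac mixed_vac_gen).
Qed.

Lemma monomial_level y : e = (degree y)%:R -> mono y \in W.
Proof. by move=> ey; rewrite inE degree_monomial ey. Qed.

End Level.

(** Such a vector is orthogonal to all monomials, hence expands over the family indexed by
    [void]. *)
Lemma level_empty e v : (forall n : nat, e != n%:R) -> v \in level e -> v = 0.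
Proof.
move=> en vW; pose f (i : void) : {ffun 'I_3 * 'I_2 -> nat} := match i with end.
have [||c ->] := @level_expand void f v; first by case.
  by move=> y _; apply: level_dot0 vW (en _).
by rewrite big1 //; case.
Qed.

Lemma level_weight_basis N m :
  weight_basis L0 (level N%:R) m (fun i : weight_index N m => mono (weight_exponent i)).
Proof.
split.
- apply: (orth_free (dot := dot)).
  have [m0 mo] := monomial_orth mixed_ccr circ_norm_gt0 mixed_adj vac_neq0 mixed_an_vac.
  by split=> // i j ij; apply: mo => /weight_exponent_inj.
- by move=> i; apply: monomial_level; have [->] := weight_exponent_degree i.
- move=> i /=; rewrite weight_monomial; have [_ ->] := weight_exponent_degree i.
  by rewrite natrD addrK.
move=> u uW L0u; apply: level_expand; first exact: weight_exponent_inj.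
move=> y yi; have [ey|ey] := eqVneq (N%:R : C) (degree y)%:R; last exact: level_dot0 uW ey.
have degy : degree y = N by apply/eqP; rewrite -(eqr_nat C) ey.
apply: (dot_eigen0 _ L0u (weight_monomial y)).
- by move=> u' v'; apply: bil_adj; exact: A0_adj.
- by rewrite rmorphB !rmorph_nat.
apply/eqP => my; have [|i iy] := weight_exponent_surj degy (m := m); last exact: (yi i).
by apply/eqP; rewrite -(eqr_nat C) natrD my subrK.
Qed.

(** In degree N no exponent exceeds N; this makes the monomials of the level a finite family. *)
Definition bounded_exponent N (x : {x : {ffun 'I_3 * 'I_2 -> 'I_N.+1} |
  (\sum_g x g == N)%N}) : {ffun 'I_3 * 'I_2 -> nat} := [ffun g => val (val x g)].

Lemma bounded_exponent_inj N : injective (@bounded_exponent N).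
Proof.
move=> x y /ffunP xy; apply/val_inj/ffunP => g; apply: val_inj.
by have := xy g; rewrite !ffunE.
Qed.

Lemma bounded_exponent_degree N x : degree (@bounded_exponent N x) = N.
Proof.
rewrite /degree -[RHS](eqP (valP x)); apply: eq_bigr => g _; by rewrite ffunE.
Qed.

Lemma level_span N v : v \in level N%:R ->
  spanned_by (fun x => mono (@bounded_exponent N x)) v.
Proof.
move=> vW; apply: level_expand; first exact: bounded_exponent_inj.
move=> y yx; have [ey|ey] := eqVneq (N%:R : C) (degree y)%:R; last exact: level_dot0 vW ey.
have degy : degree y = N by apply/eqP; rewrite -(eqr_nat C) ey.
have yN g : (y g < N.+1)%N by rewrite ltnS -degy /degree (bigD1 g) //= leq_addr.
pose x : {ffun 'I_3 * 'I_2 -> 'I_N.+1} := [ffun g => Ordinal (yN g)].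
have xN : (\sum_g x g == N)%N.
  by rewrite -[X in _ == X]degy; apply/eqP; apply: eq_bigr => g _; rewrite ffunE.
case: (yx (exist _ x xN)); apply/ffunP => g; by rewrite !ffunE.
Qed.

(** [L0] is diagonal on the monomials of degree N, with integral eigenvalues between -N and N. *)
Lemma level_char_prod N v : v \in level N%:R ->
  char_prod L0 [seq i%:R - N%:R | i <- iota 0 (2 * N).+1] v = 0.
Proof.
move=> /level_span[c ->]; rewrite char_prod_sum big1 // => x _.
rewrite (char_prod_eigen _ (weight_monomial _)) big_map.
set y := bounded_exponent x; have := bounded_exponent_degree x; rewrite -/y degreeE => Ny.
have iy : (row_degree y 0%R + N - row_degree y 1%R)%N \in iota 0 (2 * N).+1.
  by rewrite mem_iota; lia.
rewrite (big_rem _ iy) /= natrB; last by lia.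
rewrite natrD [_ - _ - _](_ : _ = 0); last by ring.
by rewrite mul0r scale0r scaler0.
Qed.

Section Multiplicity.
Variables (X : Type) (T : X -> V -> V).
Hypothesis stT : forall U : {pred V}, submod_closed U ->
  stable_under T U <-> sl2_stable L0 Lp Lm U.

Lemma level_multiplicity N j k :
  multiplicity_of_dim T (level N%:R) (2 * j + 1)%N k <->
  k = mult N j.
Proof.
have uniq_k k' : multiplicity_of_dim T (level N%:R) (2 * j + 1)%N k' ->
    k' = mult N j.
  move=> mk'; apply/eqP; rewrite -(eqn_add2r (weight_dim N j.+1)) weight_dim_mult.
  apply/eqP; apply: (multiplicity_unique L0p L0m Lpm (fun u v => bil_adj u v (A0_adj C))
    (level_submod _) (@level_char_prod N) stT _ mk').
  move=> m; exists (weight_index N m), (fun i => mono (weight_exponent i)).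
  by split; [exact: card_weight_index | exact: level_weight_basis].
split=> [/uniq_k//|->].
have [k' mk'] := multiplicity_exists L0p L0m Lpm (fun u v => bil_adj u v (A0_adj C))
    (fun u v => bil_adj u v (Ap_adj C)) (level_submod _) (@level_stable _) (@level_char_prod N)
    (@level_span N) stT (2 * j + 1)%N.
by rewrite -(uniq_k _ mk').
Qed.

(** The level is zero, so it contains no irreducible summand, and the empty decomposition is one. *)
Lemma level_multiplicity0 (e : C) d k : (forall n : nat, e != n%:R) ->
  multiplicity_of_dim T (level e) d k <-> k = 0%N.
Proof.
move=> en; split=> [[r [U [dimU [irrU _ sumU ->]]]]|->].
  have subU i : submod_closed (U i) by case: (irrU i).
  apply: eq_card0 => i; have [_ _ [u uU u0] _] := irrU i.
  have := level_empty en (direct_sum_of_sub (level_submod e) subU sumU uU).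
  by move/eqP: u0.
exists 0%N, (fun=> pred0 : {pred V}), (fun=> 0%N); split=> [[]//|[]//||].
  move=> w; split=> [wW|[u [[_ ->] _]]]; last by rewrite big_ord0; case: (level_submod e).
  exists 0; split; first by split=> [[]//|]; rewrite big_ord0 (level_empty en wW).
  by move=> u _; apply/ffunP => -[].
by rewrite eq_card0 // => -[].
Qed.

End Multiplicity.
End TwoBodyOscillator.

(** * The paraboson Fock space of order one *)

Local Open Scope complex_scope.

Section CanonicalRelations.
Variables (R : realType) (V : lmodType R[i]) (I : finType).
Variables (dot : {dot V for Num.conj}) (b : bool -> I -> {linear V -> V}) (vac : V).
Hypotheses (ospb : osp_representation b) (unib : unitary_rep dot b).
Hypothesis vacb : is_vacuum 1 b vac.

(** The scalar that [b_a^x, b_c^y] has to equal under the canonical relations. *)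
Definition symplectic (x : bool) (a : I) (y : bool) (c : I) : R[i] :=
  (sgn _ y - sgn _ x) / 2 * (a == c)%:R.

Definition boson_pred : {pred V} := [pred v | `[< forall x a y c,
  b x a (b y c v) - b y c (b x a v) = symplectic x a y c *: v >]].

Lemma boson_pred_submod : submod_closed boson_pred.
Proof.
split; first by apply/asboolP => x a y c; rewrite !linear0 addr0.
move=> k u v /asboolP uW /asboolP vW; apply/asboolP => x a y c.
have bP z d u' v' : b z d (k *: u' + v') = k *: b z d u' + b z d v' by exact: linearP.
rewrite !bP scalerDr -vW scalerA [_ * k]mulrC -scalerA -uW scalerBr opprD.
by rewrite -!addrA; congr (_ + _); rewrite addrCA.
Qed.

Lemma dot_inj u v : (forall w, dot u w = dot v w) -> u = v.
Proof.
move=> uv; apply/eqP; rewrite -subr_eq0 -(dnorm_eq0 dot) linearBl /= uv.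
by rewrite subrr.
Qed.

(* Modulo the commutators already known on [v], a product of three generators
   applied to [v] depends only on its first factor.  For the three resulting
   values [d_i], the osp relations read [d_i + d_j = 2 d_k] cyclically, so all
   agree. *)
Lemma boson_pred_stable : stable_under (all_ops b) boson_pred.
Proof.
move=> [z k] v /asboolP vW; rewrite /all_ops /=; apply/asboolP => x a y c.
have osp3 x1 a1 x2 a2 x3 a3 : b x1 a1 (b x2 a2 (b x3 a3 v)) + b x2 a2 (b x1 a1 (b x3 a3 v))
    - (b x3 a3 (b x1 a1 (b x2 a2 v)) + b x3 a3 (b x2 a2 (b x1 a1 v))) =
    (2 * symplectic x1 a1 x3 a3) *: b x2 a2 v + (2 * symplectic x2 a2 x3 a3) *: b x1 a1 v.
  have := ospb x1 x2 x3 a1 a2 a3 v; rewrite /comm_op /anticomm_op linearD => ->.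
  by rewrite /symplectic; congr (_ *: _ + _ *: _); field.
have W3 x1 a1 x2 a2 x3 a3 : b x1 a1 (b x2 a2 (b x3 a3 v)) - b x1 a1 (b x3 a3 (b x2 a2 v)) =
    symplectic x2 a2 x3 a3 *: b x1 a1 v.
  by rewrite -linearB vW linearZ.
have symC x1 a1 x2 a2 : symplectic x2 a2 x1 a1 = - symplectic x1 a1 x2 a2.
  by rewrite /symplectic [a2 == a1]eq_sym; field.
(* Pairing with an arbitrary [w] turns vector identities into scalar ones, within reach of
   [ring]. *)
apply: dot_inj => w.
have := congr1 (dot ^~ w) (osp3 x a y c z k).
have := congr1 (dot ^~ w) (osp3 y c z k x a).
have := congr1 (dot ^~ w) (W3 x a y c z k).
have := congr1 (dot ^~ w) (W3 y c x a z k).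
have := congr1 (dot ^~ w) (W3 z k x a y c).
rewrite (symC x a y c) (symC x a z k).
rewrite !(linearDl, linearNl) /= !linearZl_LR /=.
set Tzxy := dot (b z k (b x a (b y c v))) w.
set Tzyx := dot (b z k (b y c (b x a v))) w.
set Tyxz := dot (b y c (b x a (b z k v))) w.
set Tyzx := dot (b y c (b z k (b x a v))) w.
set Txyz := dot (b x a (b y c (b z k v))) w.
set Txzy := dot (b x a (b z k (b y c v))) w.
set X := dot (b x a v) w; set Y := dot (b y c v) w; set Z := dot (b z k v) w.
set sxy := symplectic x a y c; set sxz := symplectic x a z k; set syz := symplectic y c z k.
move=> /eqP + /eqP + /eqP; rewrite !subr_eq => /eqP E1 /eqP E2 /eqP E3.
rewrite E1 E2 E3 => E4 E5; apply: (mulfI (_ : 3 != 0)); first by rewrite pnatr_eq0.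
(* Once [E1], [E2], [E3] are substituted, this combination of the two osp relations is three times
   the goal. *)
have := congr2 (fun p q => - (2 * p + q)) E4 E5 => E6.
apply/eqP; rewrite -subr_eq0; move/eqP: E6; rewrite -subr_eq0 => /eqP <-.
apply/eqP; ring.
Qed.

(** For general p, b_d^- b_a^+ b_c^+ |0> = (2-p) delta_dc b_a^+ |0> + p delta_da b_c^+ |0>. For p =
    1 this is symmetric in a and c, which settles the relations on the vacuum; they spread to [V]
    because [boson_pred] is a stable subspace. *)
Lemma canonical_commutation : boson_ccr (b true) (b false).
Proof.
have [vac0 anvac antivac vacgen] := vacb.
have two_neq0 : 2 != 0 :> R[i] by rewrite pnatr_eq0.
have anb a c : b false a (b true c vac) = (a == c)%:R *: vac.
  by have := antivac a c; rewrite /anticomm_op anvac linear0 addr0 mul1r.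
have anbb d a c : b false d (b true a (b true c vac)) =
    (d == c)%:R *: b true a vac + (d == a)%:R *: b true c vac.
  have := ospb false true true d a c vac.
  rewrite /comm_op [anticomm_op _ _ vac]antivac /anticomm_op anb linearZ /= /sgn.
  rewrite subrr mul0r scale0r addr0 opprK mul1r linearZ /=.
  move/(canRL (subrK _))/(canRL (addrK _)) => ->.
  rewrite addrAC -scalerBl; by congr (_ *: _ + _); ring.
have vacW : vac \in boson_pred.
  apply/asboolP => -[] a [] c; rewrite /symplectic /sgn ?subrr ?mul0r ?scale0r.
  (* [X] = [b_a^+, b_c^+] |0> is killed by every b_d^- and is itself a sum of images of creation
     operators, so it is orthogonal to itself. *)
  - set X := _ - _; have anX d : b false d X = 0.
      by rewrite /X linearB !anbb [X in _ - X]addrC subrr.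
    apply/eqP; rewrite -(dnorm_eq0 dot) {2}/X linearBr /=.
    by rewrite -!(unib false) !anX !linear0 !linear0l subrr.
  - by rewrite anvac linear0 sub0r anb -scaleNr eq_sym; congr (_ *: _); field.
  - by rewrite anvac linear0 subr0 anb; congr (_ *: _); field.
  - by rewrite !anvac !linear0 addr0.
have bW v x a y c : b x a (b y c v) - b y c (b x a v) = symplectic x a y c *: v.
  by have /asboolP := vacgen _ boson_pred_submod vacW boson_pred_stable v.
split=> g h v; apply/eqP; rewrite -subr_eq0 ?opprD ?addrA bW /symplectic /sgn.
- by rewrite subrr !mul0r scale0r.
- by rewrite subrr !mul0r scale0r.
by rewrite subr_eq0; apply/eqP; congr (_ *: _); field.
Qed.

End CanonicalRelations.

(** * Angular momentum and energy in canonical form *)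

Section ParabosonOrderOne.
Variables (R : realType) (V : lmodType R[i]).
Variables (dot : {dot V for Num.conj}) (b : bool -> 'I_3 * 'I_2 -> {linear V -> V}).
Variables (hbar omega : R).
Hypotheses (hbar_gt0 : 0 < hbar) (omega_gt0 : 0 < omega).
Hypothesis fockV : paraboson_fock 1 dot b.

Local Notation C := R[i].
Local Notation bil := (bilinear_op (b true) (b false)).

Lemma fock_ccr : boson_ccr (b true) (b false).
Proof.
by case: fockV => ospb unib _ [vac vacb]; exact: canonical_commutation ospb unib vacb.
Qed.

Lemma creation_adj g u v : dot (b true g u) v = dot u (b false g v).
Proof. by case: fockV => _ unib _ _; rewrite unib. Qed.

Lemma levi_civita_diag (j k : 'I_3) : levi_civita j k k = 0.
Proof. by case: j k => -[|[|[|//]]] ? [[|[|[|//]]] ?]. Qed.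

(** Normal ordering doubles the bilinear term, which cancels the 1/2, and adds a term with k = l
    that the Levi-Civita symbol kills. *)
Lemma angular_momentum_bilinear j v :
  angular_momentum hbar b j v = hbar%:C%C *: bil (ang_mx C j) v.
Proof.
have [_ _ anC] := fock_ccr.
rewrite /angular_momentum /bilinear_op !scaler_sumr; apply: eq_bigr => i _.
rewrite !scaler_sumr; apply: eq_bigr => k _.
rewrite !scaler_sumr; apply: eq_bigr => l _.
rewrite /anticomm_op anC mxE; case: eqP => [[->]|_].
  by rewrite levi_civita_diag mulr0z mulr0 !scale0r !scaler0.
rewrite scale0r addr0 -[X in X + X]scale1r -scalerDl !scalerA; congr (_ *: _).
by field.
Qed.

(** Normal ordering leaves a zero-point contribution 1/2 for each of the six modes, hence the 3. *)
Lemma hamiltonian_bilinear v :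
  hamiltonian hbar omega b v = (hbar * omega)%:C%C *: (bil 1%:M v + 3 *: v).
Proof.
have [_ _ anC] := fock_ccr.
rewrite /hamiltonian /anticomm_op.
under eq_bigr do rewrite anC eqxx scale1r addrA -[X in X + X + _]scale1r -scalerDl.
rewrite big_split /= sumr_const card_prod !card_ord -scaler_sumr.
rewrite -diag_const_mx bilinear_op_diag.
under [in RHS]eq_bigr do rewrite mxE scale1r.
rewrite rmorphM fmorphV rmorph_nat /= -(scaler_nat _ v) !scalerDr !scalerA.
by congr (_ *: _ + _ *: _); field.
Qed.

Lemma angular_momentum_stable (U : {pred V}) : submod_closed U ->
  stable_under (angular_momentum hbar b) U <->
  sl2_stable (bil (A0 C)) (bil (Ap C)) (bil (Am C)) U.
Proof.
move=> subU; apply: iff_trans (rotation_stable (b true) (b false) subU).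
split=> [stU j u uU|stU j u uU].
  have h0 : hbar%:C%C != 0 :> C by rewrite fmorph_eq0 gt_eqF.
  rewrite -[bil _ u](scalerK h0) -angular_momentum_bilinear.
  by apply: (submodZ _ subU); exact: stU.
by rewrite angular_momentum_bilinear; apply: (submodZ _ subU); exact: stU.
Qed.

Lemma hamiltonian_eigenspace (E : rat) :
  eigenspace_op (hamiltonian hbar omega b) (hbar * omega * ratr E)%:C%C =
  level (b true) (b false) ((ratr E)%:C%C - 3).
Proof.
apply/funext => v; rewrite /eigenspace_op /level /= hamiltonian_bilinear.
have h0 : (hbar * omega)%:C%C != 0 :> C by rewrite fmorph_eq0 gt_eqF // mulr_gt0.
rewrite (rmorphM (real_complex R) (hbar * omega)) /= -scalerA (inj_eq (scalerI h0)).
by rewrite scalerBl [RHS]eq_sym subr_eq eq_sym.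
Qed.

Lemma hamiltonian_multiplicity (E : rat) (j k : nat) :
  multiplicity_of_dim (angular_momentum hbar b)
    (eigenspace_op (hamiltonian hbar omega b) (hbar * omega * ratr E)%:C%C) (2 * j + 1)%N k
  <-> k = if E \is a Num.nat then
            let n := Num.truncn E in if (3 <= n)%N then mult (n - 3) j else 0%N
          else 0%N.
Proof.
have [_ _ _ [vac [vac0 an_vac _ vacgen]]] := fockV.
have vac_gen (U : {pred V}) : submod_closed U -> vac \in U ->
    (forall g u, u \in U -> b true g u \in U /\ b false g u \in U) -> forall v, v \in U.
  by move=> subU vacU stU; apply: vacgen => // -[[] g] u /(stU g)[].
rewrite hamiltonian_eigenspace.
have Ee (n : nat) : (ratr E)%:C%C - 3 = n%:R :> C -> E = (n + 3)%:R.
  move=> /eqP; rewrite subr_eq -natrD -(rmorph_nat (real_complex R)) (inj_eq (fmorph_inj _)).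
  by rewrite -(ratr_nat R) (inj_eq (fmorph_inj _)) => /eqP.
have [/natrP[n En]|EN] := boolP (E \is a Num.nat); last first.
  apply: (level_multiplicity0 fock_ccr vac0 an_vac creation_adj vac_gen) => n.
  apply/eqP => /Ee En.
  by rewrite En natr_nat in EN.
rewrite En natrK /=; have [n3|n3] := ltnP 2 n.
  rewrite ratr_nat rmorph_nat -natrB //.
  exact: (level_multiplicity fock_ccr vac0 an_vac creation_adj vac_gen
    angular_momentum_stable).
(* Here n < 3, so the number eigenvalue n - 3 is negative and the level is zero. *)
apply: (level_multiplicity0 fock_ccr vac0 an_vac creation_adj vac_gen) => l.
apply/eqP; rewrite -En => /Ee.
rewrite En => /eqP; rewrite eqr_nat => /eqP nl; lia.
Qed.

End ParabosonOrderOne.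

Theorem mainTheorem3 (R : realType) (V : lmodType R[i])
    (dot : {dot V for Num.conj})
    (b : bool -> 'I_3 * 'I_2 -> {linear V -> V})
    (hbar omega : R) (hbar_gt0 : 0 < hbar) (omega_gt0 : 0 < omega)
    (fockV : paraboson_fock 1 dot b) :
  exists m : rat -> nat -> nat,
    (forall (E : rat) (j k : nat),
       multiplicity_of_dim (angular_momentum hbar b)
         (eigenspace_op (hamiltonian hbar omega b)
            (hbar * omega * ratr E)%:C)
         (2 * j + 1)%N k
       <-> k = m E j) /\
    exists G : nat -> {poly int},
      is_generating_series m G /\
      is_series_quotient G
        ((1 + Jvar * zvar ^+ 2) * zvar ^+ 3)
        ((1 - zvar ^+ 2) ^+ 3 * (1 - Jvar * zvar) ^+ 2).
Proof.
(* The witness [m] is the right side of [hamiltonian_multiplicity], found by unification. *)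
eexists; split.
  by move=> E j k; exact: (hamiltonian_multiplicity hbar_gt0 omega_gt0 fockV).
exists series_coef; split; split.
- by move=> E j /negPf->.
- move=> n j; rewrite natr_nat natrK /series_coef /=.
  case: ifP => _; last by rewrite coef0.
  (* Cutting the polynomial at degree n - 3 loses nothing, since [mult] is 0 beyond it. *)
  by rewrite coef_poly; case: ltnP => // nj; rewrite /mult leqNgt nj.
- by rewrite -horner_coef0 !hornerE /= expr0n /= !subr0 expr1n !mul1r unitr1.
- exact: series_quotient.
Qed.
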